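(* Let $L,a,b,c>0$ be constants and let $p\in L^1[0,L]$ satisfy $p\ge0$ and $$\frac{2a^2M^2}{bL^2N}>\|p\|_1 .$$ Consider the boundary value problem $$w''''(x)-\Big(a+b\int_0^Lw(t)\,dt\Big)w''(x)+c\int_0^Lw(t)\,dt=p(x),\quad x\in(0,L),\qquad w(0)=w(L)=w''(0)=w''(L)=0,$$ and let $w=S\varphi$ be its solution corresponding to the unique fixed point $\varphi$ of the operator $A$ in the closed ball $B[0,2\|p\|_1]$ (see context). Then $$\int_0^Lw(x)\,dx\ge0 .$$ Consequently, the boundary value problem has a unique solution in $W^{4,1}[0,L]$ with nonnegative integral over $[0,L]$.
   Context: $\|\cdot\|_1$ is the norm of $L^1[0,L]$, and $B[0,2\|p\|_1]=\{\varphi\in L^1[0,L]:\|\varphi\|_1\le2\|p\|_1\}$. Differential equations (and $p\ge0$) are understood almost everywhere; solutions are functions in $W^{4,1}[0,L]$. Notation: $$M=1+c\Big(\frac{L^3}{12a}-\frac{L}{a^2}+\frac{2}{a^{5/2}}\tanh\frac{\sqrt aL}{2}\Big),\qquad N=1+c\Big(\frac{5L^3}{24a}-\frac{L}{a^2}+\frac{1}{a^{5/2}}\big(2-\tfrac{aL^2}{4}\big)\tanh\frac{\sqrt aL}{2}\Big).$$ Let $G:[0,L]^2\to\mathbb R$ be the Green function of $w\mapsto w''''-aw''$ with boundary conditions $w(0)=w(L)=w''(0)=w''(L)=0$, i.e. $G(x,s)=\frac{x(L-s)}{aL}-\frac{\sinh(\sqrt a x)\sinh(\sqrt a(L-s))}{a\sqrt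 a\sinh(\sqrt aL)}$ for $0\le x\le s\le L$, and $G(x,s)=G(s,x)$ for $s\le x$. For $\varphi\in L^1[0,L]$, the linear problem $w''''-aw''+c\int_0^Lw(t)\,dt=\varphi$ on $(0,L)$, $w(0)=w(L)=w''(0)=w''(L)=0$, has a unique solution $w=S\varphi\in W^{4,1}[0,L]$, given by $$(S\varphi)(x)=\int_0^LG(x,s)\varphi(s)\,ds-\frac{c\int_0^LG(x,s)\,ds}{1+c\int_0^L\int_0^LG(t,s)\,ds\,dt}\int_0^L\int_0^LG(t,s)\varphi(s)\,ds\,dt .$$ The operator $A:L^1[0,L]\to L^1[0,L]$ is defined by $$(A\varphi)(x)=p(x)+b\Big(\int_0^Lw(t)\,dt\Big)w''(x),\qquad w=S\varphi .$$ Under the stated norm condition on $p$, $A$ has a unique fixed point $\varphi$ in $B[0,2\|p\|_1]$, and $w=S\varphi$ is then a solution of the boundary value problem. *)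

(* Defs.v *)
From HB Require Import structures.
From mathcomp Require Import all_boot all_order all_algebra.
From mathcomp Require Import all_classical all_reals all_analysis.

Set Implicit Arguments.
Unset Strict Implicit.
Unset Printing Implicit Defensive.

Import Order.TTheory GRing.Theory Num.Theory.
Import numFieldNormedType.Exports.

Local Open Scope classical_set_scope.
Local Open Scope ring_scope.

Definition sinh {R : realType} (x : R) : R := (expR x - expR (- x)) / 2.
Definition cosh {R : realType} (x : R) : R := (expR x + expR (- x)) / 2.
Definition tanh {R : realType} (x : R) : R := sinh x / cosh x.

(* Elements of L^1[0,L] are represented by functions R -> R, of which only the
   restriction to [0,L] matters; equality in L^1[0,L] is [aeEq]. *)

Definition L1 {R : realType} (L : R) (f : R -> R) : Prop :=
  (@lebesgue_measure R).-integrable `[0, L] (EFin \o f).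

Definition integ {R : realType} (L : R) (f : R -> R) : R :=
  \int[@lebesgue_measure R]_(x in `[0, L]) f x.

Definition normL1 {R : realType} (L : R) (f : R -> R) : R :=
  integ L (fun x => `|f x|).

Definition aeEq {R : realType} (L : R) (f g : R -> R) : Prop :=
  {ae @lebesgue_measure R, forall x, x \in `[0, L] -> f x = g x}.

Definition ballL1 {R : realType} (L r : R) (f : R -> R) : Prop :=
  L1 L f /\ normL1 L f <= r.

Definition abs_continuous {R : realType} (D : set R) (f : R -> R) : Prop :=
  forall e : R, 0 < e -> exists2 d : R, 0 < d &
    forall (n : nat) (u v : 'I_n -> R),
      (forall i, [/\ D (u i), D (v i) & u i <= v i]) ->
      trivIset setT (fun i => [set` `]u i, v i[]) ->
      \sum_(i < n) (v i - u i) < d ->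
      \sum_(i < n) `|f (v i) - f (u i)| < e.

(* W^{4,1}[0,L]: the functions of class C^3 on [0,L] whose third derivative is
   absolutely continuous.  Absolute continuity of w''' on the open interval
   gives w', w'', w''' finite limits at 0 and L, so derivatives are only taken
   inside (0,L), where they do not depend on the values of w outside [0,L].
   The fourth derivative exists a.e. and is integrable. *)
Definition W41 {R : realType} (L : R) (w : R -> R) : Prop :=
  [/\ {within `[0, L], continuous w},
      forall (k : nat) (x : R), (k < 3)%N -> x \in `]0, L[ ->
        derivable (derive1n k w) x 1
    & abs_continuous `]0, L[ (derive1n 3 w)].

(* The boundary values of w'' are those of its continuous extension to [0,L]. *)
Definition bvp_solution {R : realType} (L a b c : R) (p w : R -> R) : Prop :=
  [/\ W41 L w,
      {ae @lebesgue_measure R, forall x, x \in `]0, L[ ->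
        derive1n 4 w x - (a + b * integ L w) * derive1n 2 w x + c * integ L w = p x},
      w 0 = 0 /\ w L = 0
    & derive1n 2 w x @[x --> 0^'+] --> (0 : R) /\
      derive1n 2 w x @[x --> L^'-] --> (0 : R)].

Definition green_le {R : realType} (L a x s : R) : R :=
  x * (L - s) / (a * L)
  - sinh (Num.sqrt a * x) * sinh (Num.sqrt a * (L - s))
    / (a * Num.sqrt a * sinh (Num.sqrt a * L)).

Definition green {R : realType} (L a x s : R) : R :=
  if x <= s then green_le L a x s else green_le L a s x.

Definition opS {R : realType} (L a c : R) (phi : R -> R) (x : R) : R :=
  integ L (fun s => green L a x s * phi s)
  - c * integ L (fun s => green L a x s)
    / (1 + c * integ L (fun t => integ L (fun s => green L a t s)))
    * integ L (fun t => integ L (fun s => green L a t s * phi s)).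

Definition opA {R : realType} (L a b c : R) (p phi : R -> R) (x : R) : R :=
  p x + b * integ L (opS L a c phi) * derive1n 2 (opS L a c phi) x.

(* phi is a fixed point of A, as an element of L^1[0,L], in the closed ball
   of radius 2 ||p||_1 *)
Definition fixed_point_in_ball {R : realType} (L a b c : R) (p phi : R -> R)
    : Prop :=
  ballL1 L (2 * normL1 L p) phi /\ aeEq L (opA L a b c p phi) phi.

Definition constM {R : realType} (L a c : R) : R :=
  1 + c * (L ^+ 3 / (12 * a) - L / a ^+ 2
           + 2 / (a `^ (5 / 2)) * tanh (Num.sqrt a * L / 2)).

Definition constN {R : realType} (L a c : R) : R :=
  1 + c * (5 * L ^+ 3 / (24 * a) - L / a ^+ 2
           + 1 / (a `^ (5 / 2)) * (2 - a * L ^+ 2 / 4)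
             * tanh (Num.sqrt a * L / 2)).

(* Main.v *)
(** Write [z] for the integral of [w] and [k = a + b z]: the problem reads
    [w'''' - k w'' = p - c z]. For a fixed point in the ball, the smallness of [p] forces
    [b |z| < a], so [k > 0]; if moreover [z < 0], then [p - c z >= 0] and the maximum
    principle, applied to [- w''] and then to [w], gives [w >= 0], a contradiction. For
    [z >= 0], testing with the solution [g_k] of [g'''' - k g'' = 1] turns the problem
    into the scalar equation [z (1 + c \int g_k) = \int g_k p]. Since [g_k] decreases and
    [k g_k] increases with [k], this equation has exactly one root [z >= 0], which yields
    existence and uniqueness at once, without the contraction principle.

    Passing from [W^{4,1}] to integral identities requires that an absolutely continuous
    function is the integral of its almost everywhere derivative: the Lebesgue-Stieltjes
    measure of its total variation is dominated by the Lebesgue measure, and the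
    Radon-Nikodym density is recovered by Lebesgue differentiation. *)
Require Import Defs.
From HB Require Import structures.
From mathcomp Require Import all_boot all_order all_algebra.
From mathcomp Require Import all_classical all_reals all_analysis.
From mathcomp Require Import measurable_realfun ring lra.
Import Order.TTheory GRing.Theory Num.Theory.
Import numFieldNormedType.Exports.
Local Open Scope classical_set_scope.
Local Open Scope ring_scope.

(** * Absolutely continuous functions *)

(** In terms of the responses [g_a] and [h_a = - g_a''] to the load 1, the two constants are
    [M = 1 + c \int g_a] and [N = M + c (L^2 / 8) \int h_a], where [L^2 / 8] bounds [k g_k] for
    every [k > 0]. The smallness of [p] acts twice. A fixed point solves a problem with coefficient
    [a] and load [phi]; the ball bound must give [a + b z > 0] before the problem with coefficient
    [k] can be treated by the maximum principle, and there [N] enters only through [M <= N].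
    Conversely, the load [p + b z w''] built from a root of the scalar equation must be shown to lie
    in the ball, and this estimate is the origin of [N]. Equations hold only almost everywhere and
    pointwise derivatives are controlled only inside []0, L[]. Computations are therefore made on
    chains of primitives, and the maximum principles come from the monotonicity of Wronskians
    instead of second derivatives at an extremum. *)

Definition variation_modulus {R : realType} (D : set R) (f : R -> R) (e d : R) :=
  forall (I : finType) (u v : I -> R),
    (forall i, [/\ D (u i), D (v i) & u i <= v i]) ->
    trivIset setT (fun i => [set` `]u i, v i[]) ->
    \sum_i (v i - u i) < d -> \sum_i `|f (v i) - f (u i)| < e.

(** Arbitrary finite index types are wanted because subdividing each interval of a family yields a
    family indexed by pairs. *)
Lemma abs_continuous_modulus {R : realType} {D : set R} {f : R -> R} :
  abs_continuous D f ->
  forall e, 0 < e -> exists2 d, 0 < d & variation_modulus D f e d.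
Proof.
move=> acf e /acf[d d0 H]; exists d => // I u v uv tI sd.
have bE := onW_bij (fun=> true) (@enum_val_bij I).
rewrite (reindex _ bE) /=; apply: (H _ (u \o enum_val) (v \o enum_val)).
- by move=> i; exact: uv.
- by move=> i j _ _ /= ij; apply: enum_val_inj; exact: tI ij.
- by rewrite (reindex _ bE) in sd.
Qed.

(** Otherwise the midpoint between the larger left end and the smaller right end would lie in both
    intervals. The strict inequalities exclude degenerate intervals, which are empty and constrain
    nothing. *)
Lemma trivIset_ooP {R : realType} {I : finType} {u v : I -> R} :
  trivIset setT (fun i => [set` `]u i, v i[]) ->
  forall i j, i != j -> u i < v i -> u j < v j -> v i <= u j \/ v j <= u i.
Proof.
move=> tI i j ij uvi uvj; apply/orP; rewrite -[_ || _]negbK negb_or -!ltNge.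
apply/negP => /andP[h1 h2]; move/eqP: ij; apply; apply: tI => //.
pose m := Num.max (u i) (u j); pose M := Num.min (v i) (v j).
have mM : m < M by rewrite /m /M gt_max !lt_min uvi uvj h1 h2.
exists ((m + M) / 2); have /andP[] : (m < (m + M) / 2 < M) by rewrite !midf_lt.
rewrite /= !in_itv/= {1}/m {2}/M gt_max lt_min.
by move=> /andP[-> ->] /andP[-> ->].
Qed.

Lemma ooP_trivIset {R : realType} {I : finType} {u v : I -> R} :
  (forall i j, i != j -> u i < v i -> u j < v j -> v i <= u j \/ v j <= u i) ->
  trivIset setT (fun i => [set` `]u i, v i[]).
Proof.
move=> H i j _ _ [t []]; rewrite /= !in_itv/= => /andP[h1 h2] /andP[h3 h4].
have [//|ij] := eqVneq i j.
have uvi : u i < v i by exact: lt_trans h2.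
have uvj : u j < v j by exact: lt_trans h4.
by exfalso; have [] := H _ _ ij uvi uvj; lra.
Qed.

(** Meant for the clamping of the line onto [[a, b]], which is nondecreasing and 1-Lipschitz: it
    extends an absolutely continuous function from [[a, b]] to the whole line. *)
Lemma abs_continuous_comp {R : realType} (D E : set R) (f h : R -> R) :
  (forall x, E x -> D (h x)) ->
  (forall x y, E x -> E y -> x <= y -> h x <= h y <= h x + (y - x)) ->
  abs_continuous D f -> abs_continuous E (f \o h).
Proof.
move=> hD hlip acf e e0; have [d d0 H] := acf _ e0; exists d => // n u v uv tI sd.
apply: (H n (h \o u) (h \o v)).
- move=> i; have [Du Dv luv] := uv i; split; [exact: hD|exact: hD|].
  by have /andP[] := hlip _ _ Du Dv luv.
- apply: ooP_trivIset => i j ij /= hi hj.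
  have [Dui Dvi li] := uv i; have [Duj Dvj lj] := uv j.
  have {}li : u i < v i.
    by rewrite lt_neqAle li andbT; apply: contraTneq hi => ->; rewrite ltxx.
  have {}lj : u j < v j.
    by rewrite lt_neqAle lj andbT; apply: contraTneq hj => ->; rewrite ltxx.
  have [lij|lij] := trivIset_ooP tI _ _ ij li lj; [left|right].
    by have /andP[] := hlip _ _ Dvi Duj lij.
  by have /andP[] := hlip _ _ Dvj Dui lij.
- apply: le_lt_trans sd; apply: ler_sum => i _ /=.
  have [Du Dv luv] := uv i; have /andP[_] := hlip _ _ Du Dv luv; lra.
Qed.

Lemma abs_continuousD {R : realType} (D : set R) (f g : R -> R) :
  abs_continuous D f -> abs_continuous D g -> abs_continuous D (f \+ g).
Proof.
move=> acf acg e e0; have e20 : 0 < e / 2 by lra.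
have [d d0 H] := acf _ e20; have [d' d'0 H'] := acg _ e20.
exists (Num.min d d') => [|n u v uv tI]; first by rewrite lt_min d0.
rewrite lt_min => /andP[/(H _ _ _ uv tI) h /(H' _ _ _ uv tI) h'].
have -> : e = e / 2 + e / 2 by lra.
apply: le_lt_trans (ltrD h h'); rewrite -big_split/=; apply: ler_sum => i _.
by apply: le_trans (ler_normD _ _); rewrite opprD addrACA.
Qed.

Lemma abs_continuousN {R : realType} (D : set R) (f : R -> R) :
  abs_continuous D f -> abs_continuous D (\- f).
Proof.
move=> acf e e0; have [d d0 H] := acf _ e0; exists d => // n u v uv tI sd.
have := H n u v uv tI sd; congr (_ < _); apply: eq_bigr => i _.
by rewrite /= -opprD normrN.
Qed.

Lemma abs_continuousS {R : realType} (D E : set R) (f : R -> R) :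
  E `<=` D -> abs_continuous D f -> abs_continuous E f.
Proof.
move=> ED acf e e0; have [d d0 H] := acf _ e0; exists d => // n u v uv.
by apply: H => i; have [/ED ? /ED ? ?] := uv i.
Qed.

Lemma abs_continuous_continuous {R : realType} (f : R -> R) :
  abs_continuous setT f -> continuous f.
Proof.
move=> acf x; apply/cvgrPdist_lt => e e0.
have [d d0 H] := abs_continuous_modulus acf _ e0.
near=> y.
have xyd : `|x - y| < d by near: y; apply: cvgr_dist_lt => //; exact: cvg_id.
move: xyd; clear -H => xyd; wlog xy : x y xyd / y <= x => [wl|].
  have [|/ltW] := leP y x; first exact: wl.
  by move=> xy; rewrite distrC; apply: wl => //; rewrite distrC.
have := H unit (fun=> y) (fun=> x).
rewrite !big_const/= card_unit /= !addr0 => -> //; first by move=> [] [].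
by rewrite -[ltLHS]ger0_norm// subr_ge0.
Unshelve. all: end_near. Qed.

(** Past the end the sequence reads as its default [v], the right end point, so partitions can be
    padded to a common length with cells of length zero. *)
Lemma itv_partition_nth_le {R : realType} (u v : R) (s : seq R) :
  itv_partition u v s -> {homo nth v (u :: s) : i j / (i <= j)%N >-> i <= j}.
Proof.
move=> [ps /eqP ls] i j ij.
have srt : sorted <=%R (u :: s) by rewrite /= (sub_path _ ps)// => x y /ltW.
have [sj|js] := leqP (size (u :: s)) j.
  rewrite (nth_default _ sj).
  have [si|si] := leqP (size (u :: s)) i; first by rewrite nth_default.
  rewrite -[leRHS]ls (last_nth v).
  by apply: (sorted_leq_nth le_trans lexx v srt) => //; rewrite inE.
by apply: (sorted_leq_nth le_trans lexx v srt) => //; rewrite inE// (leq_ltn_trans ij).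
Qed.

Lemma itv_partition_nth_size {R : realType} (u v : R) (s : seq R) m :
  itv_partition u v s -> (size s <= m)%N -> nth v (u :: s) m = v.
Proof.
move=> [_ /eqP ls]; rewrite leq_eqVlt => /predU1P[<-|sm].
  by rewrite -[RHS]ls (last_nth v).
by rewrite nth_default.
Qed.

(** Once all partitions are padded to the length [m] of the longest, their cells form one disjoint
    family indexed by ['I_n * 'I_m] with the same total length, and a single use of the modulus
    bounds the sum of the variations. *)
Lemma variation_modulus_variation {R : realType} (a b : R) (f : R -> R) e d :
  variation_modulus `[a, b] f e d ->
  forall n (u v : 'I_n -> R) (s : 'I_n -> seq R),
    (forall i, [/\ a <= u i, v i <= b & itv_partition (u i) (v i) (s i)]) ->
    trivIset setT (fun i => [set` `]u i, v i[]) ->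
    \sum_i (v i - u i) < d -> \sum_i variation (u i) (v i) f (s i) < e.
Proof.
move=> fed n u v s uvs tI sd.
pose m := \max_i size (s i).
have sm i : (size (s i) <= m)%N by exact: leq_bigmax.
pose p i j := nth (v i) (u i :: s i) j.
have p_mon i : {homo p i : j k / (j <= k)%N >-> j <= k}.
  by move=> j k jk; apply: itv_partition_nth_le => //; have [] := uvs i.
have p0 i : p i 0%N = u i by [].
have pm i : p i m = v i by apply: itv_partition_nth_size => //; have [] := uvs i.
have pu i j : u i <= p i j by rewrite -p0; exact: p_mon.
have pv i j : p i j <= v i.
  have [jm|/ltnW mj] := leqP j m; first by rewrite -pm; exact: p_mon.
  rewrite /p itv_partition_nth_size//; first by have [] := uvs i.
  exact: leq_trans (sm i) mj.
have varE i : variation (u i) (v i) f (s i) = \sum_(j < m) `|f (p i j.+1) - f (p i j)|.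
  rewrite -(big_mkord xpredT (fun j => `|f (p i j.+1) - f (p i j)|)).
  rewrite /variation (big_cat_nat (leq0n _) (sm i))/= [X in _ = _ + X]big_nat_cond.
  rewrite [X in _ = _ + X]big1 ?addr0// => j /andP[/andP[sj _] _].
  have [_ _ part] := uvs i.
  by rewrite /p !itv_partition_nth_size ?subrr ?normr0// (leq_trans sj).
under eq_bigr do rewrite varE.
rewrite pair_bigA/=.
apply: (fed _ (fun ij : 'I_n * 'I_m => p ij.1 ij.2) (fun ij : 'I_n * 'I_m => p ij.1
  ij.2.+1)).
- move=> [i j] /=; have [au vb _] := uvs i; rewrite !in_itv/=.
  by split; [| |exact: p_mon]; rewrite (le_trans au)//= (le_trans _ vb).
- apply: ooP_trivIset => -[i j] [i' j'] /= ij hi hj.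
  have [ii|ii] := eqVneq i i'; last first.
    have li : u i < v i by rewrite (le_lt_trans (pu i j))// (lt_le_trans hi).
    have li' : u i' < v i' by rewrite (le_lt_trans (pu i' j'))// (lt_le_trans hj).
    have [h|h] := trivIset_ooP tI _ _ ii li li'; [left|right].
      exact: le_trans (pv _ _) (le_trans h (pu _ _)).
    exact: le_trans (pv _ _) (le_trans h (pu _ _)).
  subst i'; have jj : j != j' by apply: contra ij => /eqP ->.
  have [h|h|h] := ltngtP j j'; [left|right|].
  + exact: p_mon.
  + exact: p_mon.
  + by rewrite (val_inj h) eqxx in jj.
- rewrite -(pair_bigA _ (fun i (j : 'I_m) => p i j.+1 - p i j))/=.
  apply: le_lt_trans sd; apply: ler_sum => i _.
  rewrite -(big_mkord xpredT (fun j => p i j.+1 - p i j)).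
  by rewrite telescope_sumr// pm p0.
Qed.

Lemma total_variation_approx {R : realType} (a b : R) (f : R -> R) (e : R) :
  0 < e -> a <= b -> bounded_variation a b f ->
  exists2 s, itv_partition a b s & fine (total_variation a b f) - e < variation a b f s.
Proof.
move=> e0 ab /(bounded_variationP _ ab) fin; have := fin.
have ltT : (total_variation a b f - e%:E < total_variation a b f)%E.
  by rewrite -(fineK fin) -EFinB lte_fin ltrBlDr ltrDl.
move: ltT; rewrite {2}/total_variation => /ereal_sup_gt[_ [_ [s ps <-] <-]] lts fi.
by exists s => //; move: lts; rewrite -(fineK fi) -EFinB lte_fin.
Qed.

(** If [d] is a modulus for 1, the variation over any interval shorter than [d] is at most 1. The
    points [g n] advance by [d / 2], capped at [b], and total variations add up. *)
Lemma abs_continuous_bounded_variation {R : realType} (a b : R) (f : R -> R) :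
  a <= b -> abs_continuous `[a, b] f -> bounded_variation a b f.
Proof.
move=> ab acf; have [d d0 fd] := abs_continuous_modulus acf _ ltr01.
have small x y : a <= x -> x <= y -> y <= b -> y - x < d -> bounded_variation x y f.
  move=> ax xy yb xyd; exists 1 => _ [s ps <-].
  have := variation_modulus_variation _ _ _ _ _ fd 1 (fun=> x) (fun=> y) (fun=> s).
  rewrite !big_ord1 => H; apply/ltW/H => //.
  by move=> i j _ _ _; rewrite !ord1.
pose g (n : nat) := Num.min b (a + d / 2 * n%:R).
have gb n : g n <= b by rewrite /g ge_min lexx.
have ag n : a <= g n by rewrite /g le_min ab lerDl mulr_ge0//; lra.
have gS n : g n <= g n.+1.
  rewrite /g -(natr1 n) mulrDr addrA; set t := a + _; rewrite /Num.min.
  by case: ifPn => ?; case: ifPn => ?; lra.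
have gSd n : g n.+1 - g n < d.
  rewrite /g -(natr1 n) mulrDr addrA; set t := a + _; rewrite /Num.min.
  by case: ifPn => ?; case: ifPn => ?; lra.
have H n : bounded_variation a (g n) f.
  elim: n => [|n ih].
    have -> : g 0%N = a by rewrite /g mulr0 addr0; apply/min_idPr.
    exact: bounded_variationxx.
  apply/(bounded_variationP _ (ag _)).
  rewrite (total_variationD _ (ag n) (gS n)) fin_numD.
  apply/andP; split; first exact/(bounded_variationP _ (ag n)).
  by apply/(bounded_variationP _ (gS n))/small.
have [n bn] : exists n, b <= a + d / 2 * n%:R.
  exists (Num.bound ((b - a) / (d / 2))).
  rewrite -lerBlDl -ler_pdivrMl; last lra.
  rewrite mulrC ltW// archi_boundP// divr_ge0; lra.
by have := H n; rewrite /g; move/min_idPl : bn => ->.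
Qed.

(** The increment over each interval is the total variation of [f] there, nearly attained by some
    partition; [variation_modulus_variation] then controls all these partitions together. *)
Lemma abs_continuous_total_variation {R : realType} (a b : R) (f : R -> R) :
  a <= b -> abs_continuous `[a, b] f ->
  abs_continuous `[a, b] (fun x => fine (total_variation a x f)).
Proof.
move=> ab acf e e0; have e20 : 0 < e / 2 by lra.
have bv := abs_continuous_bounded_variation _ _ _ ab acf.
have [d d0 fd] := abs_continuous_modulus acf _ e20.
exists d => // n u v uv tI sd.
have uvab i : [/\ a <= u i, u i <= v i & v i <= b].
  by have [] := uv i; rewrite /= !in_itv/= => /andP[? ?] /andP[? ?] ?; split.
have bvuv i : bounded_variation (u i) (v i) f.
  have [au uvi vb] := uvab i.
  exact: bounded_variationl uvi vb (bounded_variationr au (le_trans uvi vb) bv).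
(* The [n] errors [eta] add up to at most [e / 2]; [n.+1] keeps [eta] positive when [n = 0]. *)
pose eta := e / 2 / n.+1%:R.
have eta0 : 0 < eta by rewrite divr_gt0.
have /choice[s sP] : forall i, exists s, itv_partition (u i) (v i) s /\
    fine (total_variation (u i) (v i) f) - eta < variation (u i) (v i) f s.
  move=> i; have [_ uvi _] := uvab i.
  by have [s ? ?] := total_variation_approx _ _ _ _ eta0 uvi (bvuv i); exists s.
have H : \sum_i variation (u i) (v i) f (s i) < e / 2.
  apply: (variation_modulus_variation _ _ _ _ _ fd) => // i.
  by have [? _ ?] := uvab i; have [? _] := sP i; split.
have dV i : `|fine (total_variation a (v i) f) - fine (total_variation a (u i) f)|
    <= variation (u i) (v i) f (s i) + eta.
  have [au uvi vb] := uvab i; have [_ lts] := sP i.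
  have bvau := bounded_variationl au (le_trans uvi vb) bv.
  rewrite (total_variationD _ au uvi) fineD; last 2 first.
    exact/(bounded_variationP _ au).
    exact/(bounded_variationP _ uvi).
  rewrite addrAC subrr add0r ger0_norm; last by rewrite fine_ge0// total_variation_ge0.
  by rewrite -lerBlDr ltW.
apply: (le_lt_trans (ler_sum _ (fun i _ => dV i))).
rewrite big_split/= sumr_const card_ord.
have : eta *+ n <= e / 2.
  rewrite /eta -mulr_natr -mulrA ger_pMr// mulrC ler_pdivrMr// mul1r ler_nat; exact: leqnSn.
lra.
Qed.

Lemma open_itv_finite_measure {R : realType} (A : set R) :
  open A -> is_interval A -> (@lebesgue_measure R A < +oo)%E ->
  exists u v : R, u <= v /\ A = `]u, v[%classic.
Proof.
move=> oA iA; have AE : A = [set` Rhull A] by rewrite RhullK// inE.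
have [->|/set0P A0] := eqVneq A set0.
  by exists 0, 0; rewrite set_itvoo0.
have : ((Rhull A).1 < (Rhull A).2)%O.
  have := A0; rewrite {1}AE => -[x] /=; rewrite itv_boundlr => /andP[h1 h2].
  by apply: (le_lt_trans h1); apply: (lt_le_trans _ h2); rewrite bnd_simp.
case: (Rhull A) AE => i j AE ij; rewrite {1}AE lebesgue_measure_itv/=.
case: i j AE ij => [bi u|[]] [bj v|[]] AE //=; rewrite ?ltNye ?ltey ?ltxx//=.
move=> uv _; exists u, v; split.
  by move: uv; case: bi {AE}; case: bj; rewrite !bnd_simp => // uv; exact: ltW.
by rewrite -(interior_itv_bnd u v bi bj) -AE; apply/esym/interior_id.
Qed.

(** * Density of the Stieltjes measure of a monotone absolutely continuous function *)

Section monotone_density.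
Context {R : realType} (g : R -> R).
Context (g_nd : nondecreasing g) (g_ac : abs_continuous setT g).

Let g_rc : right_continuous g.
Proof. exact/right_continuousW/abs_continuous_continuous. Qed.

HB.instance Definition _ := isCumulative.Build R _ R g g_nd g_rc.

Let nu := lebesgue_stieltjes_measure g.
Let mu := @lebesgue_measure R.

Lemma stieltjes_itvoc x y : x <= y -> nu `]x, y] = (g y - g x)%:E.
Proof.
move=> xy; rewrite /nu/= /lebesgue_stieltjes_measure/= /measure_extension/=.
rewrite measurable_mu_extE//=; last exact: is_ocitv.
by rewrite wlength_itv_bnd.
Qed.

(** Outer regularity encloses the null set in an open [U] of measure below [d]. Finitely many
    components of [U] are disjoint intervals of total length below [d], so the increments of [g]
    over them sum to less than [e]; countable additivity passes to all of [U]. *)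
Lemma stieltjes_dominated (E : set (measurableTypeR R)) : measurable E -> mu E = 0%E ->
  nu E = 0%E.
Proof.
move=> mE E0; apply/eqP; rewrite eq_le measure_ge0 andbT.
apply/lee_addgt0Pr => e e0; rewrite add0e.
have [d d0 gd] := g_ac _ e0.
have [|U [oU EU Ud]] := lebesgue_regularity_outer mE _ d0.
  by apply: (@le_lt_trans _ _ (mu E)) => //; rewrite E0 ltry.
have mU : measurable U by exact: open_measurable.
have {}Ud : (mu U < d%:E)%E.
  have -> : mu U = (mu (U `\` E) + mu (U `&` E))%E by exact: (measureDI mu mU mE).
  by rewrite (setIidr EU) E0 adde0.
apply: (le_trans (le_measure nu (mem_set mE) (mem_set mU) EU)).
set I := open_disjoint_itv oU.
have oI q : open (I q) by exact: open_disjoint_itv_open.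
have mI q : measurable (I q) by exact: open_measurable.
have tI : trivIset setT I by exact: open_disjoint_itv_trivIset.
have UE : U = \bigcup_q I q by exact: open_disjoint_itv_bigcup.
have sumI (m : {measure set (measurableTypeR R) -> \bar R}) n :
    (\sum_(q < n) m (I q) <= m U)%E.
  have mIn : measurable (\big[setU/set0]_(q < n) I q : set (measurableTypeR R)).
    by apply: bigsetU_measurable => q _; exact: mI.
  have <- : m (\big[setU/set0]_(q < n) I q) = (\sum_(q < n) m (I q))%E.
    apply: measure_semi_additive_ord_I; last exact: mIn.
      by move=> k _; exact: mI.
    exact: sub_trivIset tI.
  apply: le_measure; rewrite ?inE//.
  by rewrite UE; exact: bigsetU_bigcup.
have /choice[u /choice[v uvP]] : forall q, exists u v, u <= v /\ I q = `]u, v[%classic.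
  move=> q; apply: open_itv_finite_measure => //.
    exact: open_disjoint_itv_is_interval.
  apply: (le_lt_trans _ (lt_trans Ud (ltry d))).
  apply: (@le_measure _ _ _ mu (I q) U); rewrite ?inE; [exact: mI|exact: mU|].
  by rewrite UE; exact: bigcup_sup.
have cvgI := @measure_semi_sigma_additive _ _ _ nu I mI tI (bigcup_measurable (fun q _ =>
  mI q)).
suff : (lim ((fun n => \sum_(0 <= i < n) nu (I i)) @ \oo) <= e%:E)%E.
  by rewrite (cvg_lim _ cvgI)// -UE.
apply: lime_le; first by apply/cvg_ex; exists (nu (\bigcup_n I n)).
near=> n; rewrite big_mkord.
apply: (@le_trans _ _ (\sum_(q < n) (g (v q) - g (u q))%:E)%E).
  apply: lee_sum => q _; have [uv ->] := uvP q.
  rewrite -stieltjes_itvoc//; apply: le_measure; rewrite ?inE//.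
  by apply: subset_itvl; rewrite bnd_simp.
rewrite sumEFin lee_fin; apply: (le_trans _ (ltW (gd n (u \o val) (v \o val) _ _ _))).
- by apply: ler_sum => q _ /=; exact: ler_norm.
- by move=> q; have [] := uvP (val q).
- move=> i j _ _ /= [x [xi xj]]; apply/val_inj; apply: tI => //.
  by exists x; split; rewrite (uvP _).2.
- rewrite -lte_fin -sumEFin; apply: le_lt_trans (le_lt_trans (sumI mu n) Ud).
  apply: lee_sum => q _; have [uv ->] := uvP (val q).
  rewrite /= lebesgue_measure_itv/= lte_fin.
  by case: ltP => [_|vu]; [rewrite EFinB|rewrite lee_fin subr_le0].
Unshelve. all: end_near. Qed.

(** Restricting the Stieltjes measure to []a, b]] makes it finite; its Radon-Nikodym density,
    integrated over []a, x]], returns the increment of [g]. *)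
Lemma monotone_density a b : a <= b -> exists2 f : R -> R,
  mu.-integrable setT (EFin \o f) &
  forall x, a <= x <= b -> g x - g a = \int[mu]_(t in `[a, x]) f t.
Proof.
move=> ab.
have mD : measurable (`]a, b] : set (measurableTypeR R)) by [].
have Doo : (nu `]a, b] < +oo)%E by rewrite stieltjes_itvoc// ltry.
pose nuD : {finite_measure set (measurableTypeR R) -> \bar R} := mfrestr mD Doo.
have dom : nuD `<< mu.
  apply/null_content_dominatesP => E mE E0.
  rewrite /nuD/= /mfrestr /mrestr; apply: stieltjes_dominated; first exact: measurableI.
  by apply: subset_measure0 E0 => //; exact: measurableI.
have [f [f0 ffin intf fE]] := radon_nikodym_sigma_finite dom.
have fF : EFin \o (fine \o f) = f by apply/funext => x /=; rewrite fineK.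
exists (fine \o f); first by rewrite fF.
move=> x /andP[ax xb].
rewrite -Rintegral_itv_obnd_cbnd; last by apply: (integrableS measurableT) => //; rewrite
  fF.
have /(congr1 fine) := fE `]a, x]%classic (measurable_itv _).
rewrite /nuD/= /mfrestr /mrestr setIidl; last by apply: subset_itvl; rewrite bnd_simp.
move=> H; transitivity (fine (nu `]a, x]%classic)); first by rewrite (stieltjes_itvoc a x
  ax).
rewrite [LHS]H; congr fine; apply: eq_integral => t _ /=.
by rewrite fineK.
Qed.

End monotone_density.

(** * From almost everywhere derivatives to integrals *)

Lemma aeS {R : realType} (P Q : R -> Prop) : (forall x, P x -> Q x) ->
  {ae @lebesgue_measure R, forall x, P x} -> {ae @lebesgue_measure R, forall x, Q x}.
Proof. exact: (@filterS _ _ (ae_filter_ringOfSetsType (@lebesgue_measure R))). Qed.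

Lemma aeS2 {R : realType} (P Q S : R -> Prop) : (forall x, P x -> Q x -> S x) ->
  {ae @lebesgue_measure R, forall x, P x} -> {ae @lebesgue_measure R, forall x, Q x} ->
  {ae @lebesgue_measure R, forall x, S x}.
Proof. exact: (@filterS2 _ _ (ae_filter_ringOfSetsType (@lebesgue_measure R))). Qed.

Lemma eq_ae_Rintegral {R : realType} (D : set R) (f g : R -> R) :
  measurable D ->
  (@lebesgue_measure R).-integrable D (EFin \o f) ->
  (@lebesgue_measure R).-integrable D (EFin \o g) ->
  {ae @lebesgue_measure R, forall x, D x -> f x = g x} ->
  \int[@lebesgue_measure R]_(x in D) f x = \int[@lebesgue_measure R]_(x in D) g x.
Proof.
move=> mD intf intg fg; congr fine; apply: ae_eq_integral => //.
- exact: measurable_int intf.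
- exact: measurable_int intg.
- by apply: aeS fg => x fg Dx /=; rewrite fg.
Qed.

(** Jordan decomposition: [F = V - (V - F)], both parts nondecreasing and absolutely continuous, so
    the density is a difference of two. The clamping [cl] turns them into functions on the whole
    line, as Stieltjes measures require. *)
Lemma abs_continuous_density {R : realType} (a b : R) (F : R -> R) :
  a <= b -> abs_continuous `[a, b] F -> exists2 f : R -> R,
  (@lebesgue_measure R).-integrable setT (EFin \o f) &
  forall x, a <= x <= b -> F x = F a + \int[@lebesgue_measure R]_(t in `[a, x]) f t.
Proof.
move=> ab acF.
pose V x := fine (total_variation a x F).
have acV : abs_continuous `[a, b] V by exact: abs_continuous_total_variation.
have bvF := abs_continuous_bounded_variation _ _ _ ab acF.
have dV x y : a <= x -> x <= y -> y <= b -> `|F y - F x| <= V y - V x.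
  move=> ax xy yb.
  have bvx := bounded_variationl ax (le_trans xy yb) bvF.
  have bvxy := bounded_variationl xy yb (bounded_variationr ax (le_trans xy yb) bvF).
  rewrite /V (total_variationD _ ax xy) fineD; last 2 first.
    exact/(bounded_variationP _ ax).
    exact/(bounded_variationP _ xy).
  rewrite addrAC subrr add0r -lee_fin fineK; last exact/(bounded_variationP _ xy).
  exact: total_variation_ge.
pose cl (x : R) := Num.max a (Num.min x b).
have cl_ab x : a <= cl x <= b.
  by rewrite /cl; case: (leP x b) => ?; rewrite ?(max_r ab) ?ab ?lexx//; case: (leP a x)
    => ?; apply/andP; split.
have cl_lip x y : x <= y -> cl x <= cl y <= cl x + (y - x).
  move=> xy; rewrite /cl; case: (leP x b) => ?; case: (leP y b) => ?;
  rewrite ?(max_r ab); case: (leP a x) => ?; case: (leP a y) => ?; apply/andP; split; lra.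
have cl_id x : a <= x <= b -> cl x = x.
  by move=> /andP[ax xb]; rewrite /cl (min_l xb) (max_r ax).
have ac_cl f : abs_continuous `[a, b] f -> abs_continuous setT (f \o cl).
  by apply: abs_continuous_comp => [x _|x y _ _]; [rewrite /= in_itv; exact: cl_ab|exact:
    cl_lip].
have ndV : nondecreasing (V \o cl).
  move=> x y /cl_lip/andP[xy _] /=; rewrite -subr_ge0.
  have /andP[ax xb] := cl_ab x; have /andP[ay yb] := cl_ab y.
  by rewrite (le_trans _ (dV _ _ _ xy _)).
have ndVF : nondecreasing ((V \- F) \o cl).
  move=> x y /cl_lip/andP[xy _] /=; rewrite -subr_ge0.
  have /andP[ax xb] := cl_ab x; have /andP[ay yb] := cl_ab y.
  have := dV _ _ ax xy yb; have := ler_norm (F (cl y) - F (cl x)); lra.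
have [f intf fE] := monotone_density _ ndV (ac_cl _ acV) _ _ ab.
have [h inth hE] := monotone_density _ ndVF
  (ac_cl _ (abs_continuousD _ _ _ acV (abs_continuousN _ _ acF))) _ _ ab.
exists (f \- h).
  by rewrite (_ : EFin \o _ = (EFin \o f) \- (EFin \o h))%E; [exact: integrableB|].
move=> x axb; rewrite RintegralB//; last 2 first.
- exact: integrableS intf.
- exact: integrableS inth.
rewrite -fE// -hE// /= !cl_id ?lexx ?ab//; lra.
Qed.

Lemma derivable_addl {R : realType} (c : R) (f : R -> R) x :
  derivable f x 1 -> derivable (fun y => c + f y) x 1.
Proof.
by rewrite /derivable; under [in X in _ -> X]eq_fun do rewrite opprD addrACA subrr add0r.
Qed.

Lemma derive1_addl {R : realType} (c : R) (f : R -> R) x :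
  derive1 (fun y => c + f y) x = derive1 f x.
Proof.
by rewrite /derive1; under eq_fun do rewrite opprD addrACA subrr add0r.
Qed.

Lemma near_derive1 {R : realType} (f g : R -> R) (x : R) :
  (\near x, f x = g x) -> derive1 f x = derive1 g x.
Proof. by move=> fg; rewrite !derive1E; exact: near_eq_derive. Qed.

(* [derive1 F x] is a junk value where [F] is not differentiable, so the almost everywhere
   differentiability of [F] is part of what has to be proved. *)
Theorem abs_continuous_FTC {R : realType} (L : R) (F q : R -> R) :
  abs_continuous `]0, L[ F -> L1 L q ->
  {ae @lebesgue_measure R, forall x, x \in `]0, L[ -> derive1 F x = q x} ->
  forall x y, 0 < x -> x <= y -> y < L ->
  F y = F x + \int[@lebesgue_measure R]_(t in `[x, y]) q t.
Proof.
move=> acF intq Fq x y x0 xy yL.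
have acxy : abs_continuous `[x, y] F.
  apply: abs_continuousS acF => t /=; rewrite !in_itv/= => /andP[xt ty].
  by rewrite (lt_le_trans x0 xt) (le_lt_trans ty yL).
have [f intf fE] := abs_continuous_density _ _ _ xy acxy.
rewrite fE ?lexx ?xy//; congr (_ + _).
have intfS A : measurable A -> (@lebesgue_measure R).-integrable A (EFin \o f).
  by move=> mA; exact: integrableS intf.
have intqS A : measurable A -> A `<=` `[0, L] -> (@lebesgue_measure R).-integrable A
  (EFin \o q).
  by move=> mA AL; exact: integrableS intq.
have xyL : (`]x, y] : set R) `<=` `[0, L].
  by move=> t /=; rewrite !in_itv/= => /andP[? ?]; apply/andP; split; lra.
have xyL' : (`]x, y[ : set R) `<=` `[0, L].
  by move=> t /=; rewrite !in_itv/= => /andP[? ?]; apply/andP; split; lra.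
(* The end points are null. At an interior point, [F] agrees nearby with [F x] plus the integral of
   [f], so it has the same derivative, which is [f] almost everywhere by Lebesgue
   differentiation. *)
rewrite -!Rintegral_itv_obnd_cbnd ?intfS// ?intqS//.
rewrite -!Rintegral_itv_bndo_bndc ?intfS// ?intqS//.
apply: eq_ae_Rintegral => //; [exact: intfS|exact: intqS|].
have ftc := @FTC1 R f (BLeft x) (fun y => intfS _ (measurable_itv _))
  (open_integrable_locally openT intf).
have {}ftc : {ae @lebesgue_measure R, forall t, x < t -> f t =
    derive1 (fun s => \int[@lebesgue_measure R]_(t in `[x, s]) f t) t}.
  apply: aeS ftc => t H xt; have [|_ <-//] := H.
  by rewrite lte_fin.
apply: aeS2 ftc Fq => t ftc Fq /=; rewrite in_itv/= => /andP[xt ty].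
rewrite ftc// -Fq; last by rewrite in_itv/= (lt_trans x0 xt) (lt_trans ty yL).
transitivity (derive1 (fun s => F x + \int[@lebesgue_measure R]_(t in `[x, s]) f t) t).
  by rewrite derive1_addl.
apply: near_derive1; near=> s; apply/esym/fE/andP; split; apply: ltW; near: s.
  exact: lt_nbhsr.
exact: lt_nbhsl.
Unshelve. all: end_near. Qed.

(** * Primitives on [0,L] *)

Section primitives.
Context {R : realType} (L : R) (L0 : 0 < L).
Let mu := @lebesgue_measure R.
Implicit Types f g F G : R -> R.

Lemma L1_within_continuous f : {within `[0, L], continuous f} -> L1 L f.
Proof. exact/continuous_compact_integrable/segment_compact. Qed.

Lemma L1D f g : L1 L f -> L1 L g -> L1 L (fun x => f x + g x).
Proof. by move=> ? ?; rewrite /L1 (_ : EFin \o _ = (EFin \o f) \+ (EFin \o g))%E; [exact: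
  integrableD|]. Qed.

Lemma L1Zl k f : L1 L f -> L1 L (fun x => k * f x).
Proof. by move=> intf; rewrite /L1 (_ : EFin \o _ = (fun x => k%:E * (EFin \o f) x))%E;
  [exact: integrableZl|]. Qed.

Lemma L1N f : L1 L f -> L1 L (fun x => - f x).
Proof. by move=> /(L1Zl (-1)); congr L1; apply/funext => x; rewrite mulN1r. Qed.

Lemma L1B f g : L1 L f -> L1 L g -> L1 L (fun x => f x - g x).
Proof. by move=> intf /L1N; exact: L1D. Qed.

Lemma L1_bounded g : {within `[0, L], continuous g} ->
  exists2 M, 0 < M & forall x, 0 <= x <= L -> `|g x| <= M.
Proof.
move=> cg; have /compact_bounded[M [_ Mg]] := continuous_compact cg (@segment_compact _ 0
  L).
exists (`|M| + 1); first by rewrite ltr_wpDl.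
move=> x xL; apply: (Mg (`|M| + 1)); first by rewrite ltr_pwDr// ler_norm.
by exists x => //=; rewrite in_itv.
Qed.

Lemma L1Ml f g : {within `[0, L], continuous g} -> L1 L f -> L1 L (fun x => g x * f x).
Proof.
move=> cg intf; rewrite /L1 (_ : EFin \o _ = (EFin \o g) \* (EFin \o f))%E//.
apply: integrableMr => //.
  by apply: subspace_continuous_measurable_fun.
have [M M0 Mg] := L1_bounded _ cg; exists M; split; first exact: num_real.
by move=> y My x /=; rewrite in_itv/= => /Mg /le_trans; apply; exact: ltW.
Qed.

Lemma L1_norm f : L1 L f -> L1 L (fun x => `|f x|).
Proof. exact: integrable_norm. Qed.

Lemma L1_itv f (A : set R) : measurable A -> A `<=` `[0, L] -> L1 L f ->
  mu.-integrable A (EFin \o f).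
Proof. by move=> mA AL; exact: integrableS. Qed.

Lemma sub_itv_cc (x y : R) : 0 <= x -> y <= L -> `[x, y]%classic `<=` (`[0, L]%classic :
  set R).
Proof. by move=> x0 yL t /=; rewrite !in_itv/= => /andP[? ?]; apply/andP; split; lra. Qed.

(* [F' = f] in [W^{1,1}[0,L]]. In a chain of primitives the values at 0 and L are those
   of the continuous extensions, so boundary conditions are plain equalities. *)
Definition primitive F f := L1 L f /\
  forall x, 0 <= x <= L -> F x = F 0 + \int[mu]_(t in `[0, x]) f t.

Lemma primitive_L1 F f : primitive F f -> L1 L f. Proof. by case. Qed.

Lemma primitive_sub F f x y : primitive F f -> 0 <= x -> x <= y -> y <= L ->
  F y = F x + \int[mu]_(t in `[x, y]) f t.
Proof.
move=> [intf FE] x0 xy yL.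
rewrite (FE y) ?(FE x); [|by apply/andP; split; lra..].
rewrite -addrA; congr (_ + _).
rewrite -[X in _ + X]Rintegral_itv_obnd_cbnd; last first.
  by apply: L1_itv => //; apply: subset_trans (sub_itv_cc _ _ x0 yL); apply: subset_itvr;
    rewrite bnd_simp.
have <- : \int[mu]_(t in `[0, y]) f t - \int[mu]_(t in `[0, x]) f t = \int[mu]_(t in `]x,
  y]) f t.
  by apply: Rintegral_itvB; rewrite ?bnd_simp//; apply: L1_itv => //; exact: sub_itv_cc.
by rewrite addrC subrK.
Qed.

Lemma primitive_continuous F f : primitive F f -> {within `[0, L], continuous F}.
Proof.
move=> [intf FE].
have c := parameterized_integral_continuous (ltW L0) intf.
have c' : {within `[0, L], continuous (fun x => F 0 + \int[mu]_(t in `[0, x]) f t)}.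
  by move=> x; apply: cvgD; [exact: cvg_cst|exact: c].
apply: subspace_eq_continuous c' => x xL; apply/esym/FE.
by move: xL; rewrite inE/= in_itv.
Qed.

Lemma primitive_FTC1 F f : primitive F f ->
  {ae mu, forall x, x \in `]0, L[ -> derivable F x 1 /\ derive1 F x = f x}.
Proof.
move=> [intf FE].
pose fL := f \_ `[0, L].
have intfL : mu.-integrable setT (EFin \o fL).
  have H := (@integrable_mkcond _ _ _ mu `[0, L]%classic (EFin \o f) (measurable_itv
    _)).1 intf.
  by apply: eq_integrable H => // t _; rewrite /fL /= !patchE; case: ifP.
have intS A : measurable A -> mu.-integrable A (EFin \o fL).
  by move=> mA; exact: integrableS intfL.
have := @FTC1 R fL (BLeft 0) (fun y => intS _ (measurable_itv _))
  (open_integrable_locally openT intfL).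
apply: aeS => x H; rewrite in_itv/= => /andP[x0 xL].
have [|dG GE] := H _; first by rewrite lte_fin.
have FG : \near x, F 0 + (\int[mu]_(t in `[0, x]) fL t) = F x.
  near=> y; have yL : 0 <= y <= L.
    by apply/andP; split; apply: ltW; near: y; [exact: lt_nbhsr|exact: lt_nbhsl].
  rewrite (FE y)//; congr (_ + _); apply: eq_Rintegral => t; rewrite inE/= in_itv/= =>
    /andP[t0 ty].
  rewrite /fL patchE mem_set//= in_itv/= t0/= (le_trans ty)//.
  by case/andP: yL.
split.
  apply: near_eq_derivable FG _.
  exact: derivable_addl.
rewrite -(near_derive1 _ _ _ FG) derive1_addl GE /fL patchE mem_set//= in_itv/=.
by rewrite !ltW.
Unshelve. all: end_near. Qed.

Lemma primitive_derive F f x : primitive F f -> {within `[0, L], continuous f} ->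
  x \in `]0, L[ -> derivable F x 1 /\ derive1 F x = f x.
Proof.
move=> [intf FE] /(continuous_within_itvP _ L0)[cf _ _] /[dup] xoo; rewrite in_itv/= =>
  /andP[x0 xL].
have [dG GE] := @continuous_FTC1_closed R f 0 x L xL intf x0 (cf _ xoo).
have FG : \near x, F 0 + (\int[mu]_(t in `[0, x]) f t) = F x.
  near=> y; rewrite -(FE y)//.
  by apply/andP; split; apply: ltW; near: y; [exact: lt_nbhsr|exact: lt_nbhsl].
split.
  apply: near_eq_derivable FG _.
  exact: derivable_addl.
by rewrite -(near_derive1 _ _ _ FG) derive1_addl.
Unshelve. all: end_near. Qed.

Lemma primitive_ext F f G g : primitive F f ->
  (forall x, 0 <= x <= L -> F x = G x) -> (forall x, 0 <= x <= L -> f x = g x) ->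
  primitive G g.
Proof.
move=> [intf FE] FG fg; split.
  by apply: eq_integrable intf => // x; rewrite inE/= in_itv/= => /fg ->.
move=> x xL; rewrite -!FG// ?lexx ?ltW// FE//; congr (_ + _).
apply: eq_Rintegral => t; rewrite inE/= in_itv/= => /andP[t0 tx]; apply: fg.
by rewrite t0 (le_trans tx)//; case/andP: xL.
Qed.

Lemma primitiveD F f G g : primitive F f -> primitive G g ->
  primitive (fun x => F x + G x) (fun x => f x + g x).
Proof.
move=> [intf FE] [intg GE]; split; first exact: L1D.
move=> x /[dup] xL /andP[x0 xL']; rewrite RintegralD//; last 2 first.
- by apply: L1_itv => //; exact: sub_itv_cc.
- by apply: L1_itv => //; exact: sub_itv_cc.
by rewrite FE// GE// addrACA.
Qed.

Lemma primitiveZ k F f : primitive F f -> primitive (fun x => k * F x) (fun x => k * f x).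
Proof.
move=> [intf FE]; split; first exact: L1Zl.
move=> x /[dup] xL /andP[x0 xL']; rewrite RintegralZl//; last first.
  by apply: L1_itv => //; exact: sub_itv_cc.
by rewrite FE// mulrDr.
Qed.

Lemma primitiveN F f : primitive F f -> primitive (fun x => - F x) (fun x => - f x).
Proof.
move=> /(primitiveZ (-1)) H; apply: (primitive_ext _ _ _ _ H) => x _; exact: mulN1r.
Qed.

Lemma primitiveB F f G g : primitive F f -> primitive G g ->
  primitive (fun x => F x - G x) (fun x => f x - g x).
Proof. by move=> pF /primitiveN; exact: primitiveD. Qed.

Lemma within_continuous_cst (k : R) : {within `[0, L], continuous (fun=> k)}.
Proof. by move=> x; exact: cvg_cst. Qed.

Lemma primitive_cst (k : R) : primitive (fun=> k) (fun=> 0).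
Proof.
split; first exact/L1_within_continuous/within_continuous_cst.
by move=> x _; rewrite Rintegral_cst//= mul0r addr0.
Qed.

Lemma L1_primitive f : L1 L f -> primitive (fun x => \int[mu]_(t in `[0, x]) f t) f.
Proof.
by move=> intf; split=> // x _; rewrite set_itv1 Rintegral_set1 add0r.
Qed.

Lemma primitive_of_derive F f : {within `[0, L], continuous F} -> {within `[0, L],
  continuous f} ->
  (forall x, x \in `]0, L[ -> is_derive x 1 F (f x)) -> primitive F f.
Proof.
move=> cF cf dF; split; first exact: L1_within_continuous.
move=> x /andP[]; rewrite le_eqVlt => /predU1P[<- _|x0 xL].
  by rewrite set_itv1 Rintegral_set1 addr0.
have sub : `[0, x]%classic `<=` (`[0, L]%classic : set R) by exact: sub_itv_cc.
have /(continuous_within_itvP _ x0)[cFi cF0 cFx] := continuous_subspaceW sub cF.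
rewrite /Rintegral (@continuous_FTC2 _ f F 0 x)//=; last 3 first.
- exact: continuous_subspaceW cf.
- split => // t; rewrite in_itv/= => /andP[t0 tx].
  by have [] := dF t; first by rewrite in_itv/= t0 (lt_le_trans tx).
- move=> t; rewrite in_itv/= => /andP[t0 tx].
  have [] := dF t; first by rewrite in_itv/= t0 (lt_le_trans tx).
  by rewrite derive1E.
by rewrite addrCA subrr addr0.
Qed.

Lemma eq_within_continuous F G : {within `[0, L], continuous F} ->
  {within `[0, L], continuous G} -> {in `]0, L[, F =1 G} ->
  forall x, 0 <= x <= L -> F x = G x.
Proof.
move=> /(continuous_within_itvP _ L0)[_ F0 FL] /(continuous_within_itvP _ L0)[_ G0 GL] FG x.
move=> /andP[]; rewrite le_eqVlt => /predU1P[<- _|x0].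
  apply: (@cvg_unique _ _ (F @ 0^'+)) => //.
  apply: cvg_trans G0; apply: near_eq_cvg; near=> y.
  by apply/esym/FG; rewrite in_itv/=; apply/andP; split; near: y; [exact:
    nbhs_right_gt|exact: nbhs_right_lt].
rewrite le_eqVlt => /predU1P[->|xL]; last by apply: FG; rewrite in_itv/= x0.
apply: (@cvg_unique _ _ (F @ L^'-)) => //.
apply: cvg_trans GL; apply: near_eq_cvg; near=> y.
by apply/esym/FG; rewrite in_itv/=; apply/andP; split; near: y; [exact:
  nbhs_left_gt|exact: nbhs_left_lt].
Unshelve. all: end_near. Qed.

(** Only continuity is known at the ends, so [F] is compared with a primitive [G] of [f] from the
    midpoint: [F - G] is constant inside, hence on [[0, L]]. *)
Lemma primitive_of_oo F f : {within `[0, L], continuous F} -> L1 L f ->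
  (forall x y, 0 < x -> x <= y -> y < L -> F y = F x + \int[mu]_(t in `[x, y]) f t) ->
  primitive F f.
Proof.
move=> cF intf FE; split=> // x xL.
have pG := L1_primitive _ intf; set G := (G in primitive G f) in pG.
pose m := L / 2.
have cD : {within `[0, L], continuous (fun x => F x - G x)}.
  by move=> t; apply: cvgB; [exact: cF|exact: (primitive_continuous _ _ pG)].
have D x0 : 0 <= x0 <= L -> F x0 - G x0 = F m - G m.
  apply: (eq_within_continuous _ _ cD (within_continuous_cst _)) => t.
  rewrite in_itv/= => /andP[t0 tL].
  have mE : m = L / 2 by [].
  have [tm|mt] := leP t m.
    rewrite (FE t m)//; last lra.
    rewrite (primitive_sub _ _ t m pG)//; lra.
  rewrite (FE m t)//; [|lra|exact: ltW].
  rewrite (primitive_sub _ _ m t pG)//; lra.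
have := D x xL; have := D 0; rewrite lexx ltW// => /(_ isT).
rewrite -/(G x) /(G 0) set_itv1 Rintegral_set1; lra.
Qed.

Lemma abs_continuousM_oo F G : {within `[0, L], continuous F} ->
  {within `[0, L], continuous G} -> abs_continuous `]0, L[ F -> abs_continuous `]0, L[ G ->
  abs_continuous `]0, L[ (fun x => F x * G x).
Proof.
move=> /L1_bounded[M M0 FM] /L1_bounded[N N0 GN] acF acG e e0.
have eN : 0 < e / 2 / N by rewrite !divr_gt0.
have eM : 0 < e / 2 / M by rewrite !divr_gt0.
have [d d0 H] := acF _ eN; have [d' d'0 H'] := acG _ eM.
exists (Num.min d d') => [|n u v uv tI]; first by rewrite lt_min d0.
rewrite lt_min => /andP[/(H _ _ _ uv tI) h /(H' _ _ _ uv tI) h'].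
have -> : e = N * (e / 2 / N) + M * (e / 2 / M) by field; rewrite !gt_eqF.
rewrite -(ltr_pM2l N0) in h; rewrite -(ltr_pM2l M0) in h'.
apply: le_lt_trans (ltrD h h').
rewrite !mulr_sumr -big_split/=; apply: ler_sum => i _.
have [] := uv i; rewrite /= !in_itv/= => /andP[u0 uL] /andP[v0 vL] _.
have -> : F (v i) * G (v i) - F (u i) * G (u i) =
   G (v i) * (F (v i) - F (u i)) + F (u i) * (G (v i) - G (u i)) by ring.
rewrite (le_trans (ler_normD _ _))// !normrM lerD// ler_wpM2r//.
- by apply: GN; rewrite !ltW.
- by apply: FM; rewrite !ltW.
Qed.

(** The union of the intervals has measure the sum of their lengths, so the absolute continuity of
    the integral of [|f|] applies to this union. *)
Lemma primitive_abs_continuous F f : primitive F f -> abs_continuous `]0, L[ F.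
Proof.
move=> pF; have [intf _] := pF; move=> e e0.
pose fL := f \_ `[0, L].
have intfL : mu.-integrable setT (EFin \o fL).
  have H := (@integrable_mkcond _ _ _ mu `[0, L]%classic (EFin \o f) (measurable_itv
    _)).1 intf.
  by apply: eq_integrable H => // t _; rewrite /fL /= !patchE; case: ifP.
have [d [d0 fd]] := integral_normr_continuous intfL e0.
exists d => // n u v uv tI sd.
have uvL i : [/\ 0 <= u i, u i <= v i & v i <= L].
  by have [] := uv i; rewrite /= !in_itv/= => /andP[? ?] /andP[? ?] ?; split => //;
    exact: ltW.
pose A : set (measurableTypeR R) := \big[setU/set0]_(i < n) `]u i, v i[%classic.
have mA : measurable A by apply: bigsetU_measurable => i _; exact: measurable_itv.
have AE : mu A = (\sum_(i < n) (v i - u i))%:E.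
  transitivity (\sum_(i < n) mu `]u i, v i[%classic)%E.
    by apply: measure_semi_additive_ord => // i; exact: measurable_itv.
  rewrite -sumEFin; apply: eq_bigr => i _; have [_ uvi _] := uvL i.
  rewrite /mu lebesgue_measure_itv/= lte_fin; case: ltP => // vu.
  by have -> : v i = u i by [lra]; rewrite subrr.
have Ad : (mu A < d%:E)%E by rewrite AE lte_fin.
apply: le_lt_trans (fd A mA Ad).
have subA (i : 'I_n) : (`]u i, v i[%classic : set R) `<=` `[0, L].
  by move=> t /=; rewrite !in_itv/=; have [? ? ?] := uvL i => /andP[? ?]; apply/andP;
    split; lra.
have -> : \int[mu]_(x in A) `|fL x| = \sum_(i < n) \int[mu]_(x in `]u i, v i[) `|f x|.
  have intn B : measurable B -> mu.-integrable B (EFin \o (fun x => `|fL x|)).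
    by move=> mB; apply: integrable_norm; exact: integrableS intfL.
  transitivity (\sum_(i < n) \int[mu]_(x in `]u i, v i[) `|fL x|).
    rewrite /Rintegral /A integral_bigsetU_EFin/=.
    - rewrite -sum_fine// => i _.
      by apply: integrable_fin_num; [exact: measurable_itv|exact: (intn _ (measurable_itv
        _))].
    - by move=> i; exact: measurable_itv.
    - exact: index_enum_uniq.
    - exact: sub_trivIset tI.
    - exact: measurable_int (intn _ mA).
  apply: eq_bigr => i _; apply: eq_Rintegral => t; rewrite inE => /subA tL.
  by rewrite /fL patchE mem_set.
apply: ler_sum => i _; have [u0 uvi vL] := uvL i.
rewrite (primitive_sub _ _ _ _ pF u0 uvi vL) addrAC subrr add0r.
have sub := sub_itv_cc _ _ u0 vL.
apply: (le_trans (le_normr_Rintegral _ _)) => //; first by apply: L1_itv.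
rewrite -Rintegral_itv_obnd_cbnd; last first.
  apply: L1_itv (L1_norm _ intf) => //; apply: subset_trans sub; apply: subset_itvr;
    rewrite ?bnd_simp//.
rewrite -Rintegral_itv_bndo_bndc//.
by apply: L1_itv (L1_norm _ intf).
Qed.

(** The product rule is available only almost everywhere, since [f] and [g] are merely integrable;
    as the product is absolutely continuous, it is still the integral of this derivative. Every
    integration by parts below rests on this. *)
Lemma primitiveM F f G g : primitive F f -> primitive G g ->
  primitive (fun x => F x * G x) (fun x => f x * G x + F x * g x).
Proof.
move=> pF pG.
have cF := primitive_continuous _ _ pF; have cG := primitive_continuous _ _ pG.
have intfg : L1 L (fun x => f x * G x + F x * g x).
  apply: L1D; last exact: L1Ml (primitive_L1 _ _ pG).
  by under eq_fun do rewrite mulrC; exact: L1Ml (primitive_L1 _ _ pF).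
apply: primitive_of_oo => //.
  by move=> x; apply: cvgM; [exact: cF|exact: cG].
apply: abs_continuous_FTC => //.
  by apply: abs_continuousM_oo => //; [exact: primitive_abs_continuous pF|exact:
    primitive_abs_continuous pG].
apply: aeS2 (primitive_FTC1 _ _ pF) (primitive_FTC1 _ _ pG) => x dF dG xL.
have [{}dF FE] := dF xL; have [{}dG GE] := dG xL.
by rewrite derive1E (deriveM dF dG) -!derive1E FE GE addrC; congr (_ + _); exact: mulrC.
Qed.

Lemma primitive_ae F f G g : primitive F f -> primitive G g -> aeEq L f g ->
  forall x, 0 <= x <= L -> F x - F 0 = G x - G 0.
Proof.
move=> [intf FE] [intg GE] fg x /[dup] xL /andP[x0 xL'].
have sub := sub_itv_cc _ _ (lexx 0) xL'.
rewrite FE// GE// ![_ + _ - _]addrAC !subrr !add0r.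
apply: eq_ae_Rintegral => //; [exact: L1_itv|exact: L1_itv|].
by apply: aeS fg => t + tx; apply; exact: sub.
Qed.

Lemma primitive_ge0 F f : primitive F f ->
  {ae mu, forall x, x \in `[0, L] -> 0 <= f x} ->
  forall x y, 0 <= x -> x <= y -> y <= L -> F x <= F y.
Proof.
move=> pF f0 x y x0 xy yL; have [intf _] := pF.
have sub := sub_itv_cc _ _ x0 yL.
rewrite (primitive_sub _ _ _ _ pF x0 xy yL) lerDl.
rewrite (@eq_ae_Rintegral _ _ f (fun x => `|f x|))//; last 3 first.
- exact: L1_itv.
- by apply: L1_itv (L1_norm _ intf).
- by apply: aeS f0 => t f0 txy; rewrite ger0_norm// f0//; exact: sub.
exact: Rintegral_ge0.
Qed.

(** * Linear boundary value problems *)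

Lemma primitive_id : primitive (fun x => x) (fun=> 1).
Proof.
split; first exact/L1_within_continuous/within_continuous_cst.
move=> x /andP[x0 _]; rewrite Rintegral_cst//= lebesgue_measure_itv/= lte_fin.
case: ltP => [_|x0']; first by rewrite /= subr0 mul1r add0r.
by rewrite mulr0 addr0; lra.
Qed.

Lemma continuous_primitive f : {within `[0, L], continuous f} ->
  primitive (fun x => \int[mu]_(t in `[0, x]) f t) f.
Proof. by move=> cf; apply: L1_primitive; exact: L1_within_continuous. Qed.

Lemma primitive_expR (p q : R) :
  primitive (fun x => expR (p * x + q)) (fun x => p * expR (p * x + q)).
Proof.
have dE (x : R) : is_derive x 1 (fun x => expR (p * x + q)) (p * expR (p * x + q)).
  have dl : is_derive x 1 (fun y : R => p * y + q) p.
    by apply: is_derive_eq; rewrite addr0 /GRing.scale/= mulr1.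
  have := @is_derive1_comp R expR (fun y => p * y + q) x _ _ (is_derive_expR _) dl.
  by rewrite mulrC.
have cE : continuous (fun x => expR (p * x + q)).
  by move=> x; apply/differentiable_continuous/derivable1_diffP; have [] := dE x.
apply: primitive_of_derive.
- exact: continuous_subspaceT.
- by apply: continuous_subspaceT => x; apply: cvgMl_tmp; exact: cE.
Qed.

Lemma primitive_sinh (p q : R) :
  primitive (fun x => sinh (p * x + q)) (fun x => p * cosh (p * x + q)).
Proof.
have h1 := primitive_expR p q; have h2 := primitive_expR (- p) (- q).
have NE x : - p * x + - q = - (p * x + q) by ring.
apply: (primitive_ext _ _ _ _ (primitiveZ 2^-1 _ _ (primitiveB _ _ _ _ h1 h2))) => x _.
  by rewrite /sinh NE; field.
by rewrite /cosh NE; field.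
Qed.

Lemma primitive_cosh (p q : R) :
  primitive (fun x => cosh (p * x + q)) (fun x => p * sinh (p * x + q)).
Proof.
have h1 := primitive_expR p q; have h2 := primitive_expR (- p) (- q).
have NE x : - p * x + - q = - (p * x + q) by ring.
apply: (primitive_ext _ _ _ _ (primitiveZ 2^-1 _ _ (primitiveD _ _ _ _ h1 h2))) => x _.
  by rewrite /cosh NE; field.
by rewrite /sinh NE; field.
Qed.

Lemma sinhD (x y : R) : sinh (x + y) = sinh x * cosh y + cosh x * sinh y.
Proof. by rewrite /sinh /cosh opprD !expRD; field. Qed.

Lemma sinh0 : sinh (0 : R) = 0. Proof. by rewrite /sinh oppr0 subrr mul0r. Qed.

Lemma cosh0 : cosh (0 : R) = 1. Proof. by rewrite /cosh oppr0 expR0; lra. Qed.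

Lemma sinhN (x : R) : sinh (- x) = - sinh x. Proof. by rewrite /sinh opprK; lra. Qed.

Lemma coshN (x : R) : cosh (- x) = cosh x. Proof. by rewrite /cosh opprK addrC. Qed.

Lemma sinh_gt0 (x : R) : 0 < x -> 0 < sinh x.
Proof. by move=> x0; rewrite /sinh divr_gt0// subr_gt0 ltr_expR; lra. Qed.

Lemma sinh_ge0 (x : R) : 0 <= x -> 0 <= sinh x.
Proof. by rewrite le_eqVlt => /predU1P[<-|/sinh_gt0/ltW//]; rewrite sinh0. Qed.

Lemma cosh_gt0 (x : R) : 0 < cosh x.
Proof. by rewrite /cosh divr_gt0// addr_gt0// expR_gt0. Qed.

Lemma dirichlet_exists k f : 0 < k -> L1 L f ->
  exists u u1, [/\ primitive u u1, primitive u1 (fun x => k * u x + f x), u 0 = 0 & u L =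
    0].
Proof.
move=> k0 intf; pose r := Num.sqrt k.
have r0 : 0 < r by rewrite sqrtr_gt0.
have rr : r ^+ 2 = k by rewrite sqr_sqrtr// ltW.
pose e x := expR (r * x + 0); pose e' x := expR (- r * x + 0).
have ee' x : e x * e' x = 1 by rewrite /e /e' -expRD (_ : _ + _ = 0) ?expR0//; ring.
have pe : primitive e (fun x => r * e x) by exact: primitive_expR.
have pe' : primitive e' (fun x => - r * e' x) by exact: primitive_expR.
have pA := L1_primitive _ (L1Ml _ _ (primitive_continuous _ _ pe') intf).
have pB := L1_primitive _ (L1Ml _ _ (primitive_continuous _ _ pe) intf).
set A := (A in primitive A _) in pA; set B := (B in primitive B _) in pB.
have peA := primitiveM _ _ _ _ pe pA; have peB := primitiveM _ _ _ _ pe' pB.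
(* Variation of constants: [y'' - k y = f] and [y 0 = 0]. *)
pose y x := (e x * A x - e' x * B x) / (2 * r).
pose y1 x := (e x * A x + e' x * B x) / 2.
have py : primitive y y1.
  apply: (primitive_ext _ _ _ _ (primitiveZ (2 * r)^-1 _ _ (primitiveB _ _ _ _ peA peB)))
    => x _.
    by rewrite /y mulrC.
  by rewrite /y1; field; rewrite gt_eqF.
have py1 : primitive y1 (fun x => k * y x + f x).
  apply: (primitive_ext _ _ _ _ (primitiveZ 2^-1 _ _ (primitiveD _ _ _ _ peA peB))) => x _.
    by rewrite /y1 mulrC.
  have -> : e x * (e' x * f x) = f x by rewrite mulrA ee' mul1r.
  have -> : e' x * (e x * f x) = f x by rewrite mulrA [e' x * _]mulrC ee' mul1r.
  by rewrite /y -rr; field; rewrite gt_eqF.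
have y0 : y 0 = 0.
  by rewrite /y /A /B !set_itv1 !Rintegral_set1 !mulr0 subrr mul0r.
have sL : sinh (r * L + 0) != 0 by rewrite gt_eqF// sinh_gt0// addr0 mulr_gt0.
have ps := primitive_sinh r 0; have pc := primitive_cosh r 0.
(* [sinh (r x)] solves the homogeneous equation and vanishes at 0: subtracting [C] times it corrects
   the value at [L] and keeps the one at 0. *)
pose C := y L / sinh (r * L + 0).
exists (fun x => y x - C * sinh (r * x + 0)), (fun x => y1 x - C * r * cosh (r * x + 0));
  split.
- by apply: (primitive_ext _ _ _ _ (primitiveB _ _ _ _ py (primitiveZ C _ _ ps))) => x _
  //; ring.
- apply: (primitive_ext _ _ _ _ (primitiveB _ _ _ _ py1 (primitiveZ (C * r) _ _ pc))) =>
  x _ //.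
  by rewrite -rr; ring.
- by rewrite y0 mulr0 addr0 sinh0; ring.
- by rewrite /C divfK// subrr.
Qed.

(** A hinged beam carried together with its successive derivatives as explicit functions, so that
    the values of [w''] at 0 and [L] can be written directly. *)
Definition beam (w w1 w2 w3 w4 : R -> R) : Prop :=
  [/\ primitive w w1, primitive w1 w2, primitive w2 w3, primitive w3 w4
    & [/\ w 0 = 0, w L = 0, w2 0 = 0 & w2 L = 0]].

(** The problem factors: [u = w''] solves a Dirichlet problem, and two integrations of [u] followed
    by a linear correction give [w]. *)
Lemma beam_exists k f : 0 < k -> L1 L f ->
  exists w w1 w2 w3, beam w w1 w2 w3 (fun x => k * w2 x + f x).
Proof.
move=> k0 intf; have [u [u1 [pu pu1 u0 uL]]] := dirichlet_exists _ _ k0 intf.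
have pP := continuous_primitive _ (primitive_continuous _ _ pu).
set P := (P in primitive P _) in pP.
have pQ := continuous_primitive _ (primitive_continuous _ _ pP).
set Q := (Q in primitive Q _) in pQ.
have Q0 : Q 0 = 0 by rewrite /Q set_itv1 Rintegral_set1.
pose C := Q L / L.
exists (fun x => Q x - C * x), (fun x => P x - C), u, u1; split => //.
- by apply: (primitive_ext _ _ _ _ (primitiveB _ _ _ _ pQ (primitiveZ C _ _
  primitive_id))) => x _ //; ring.
- by apply: (primitive_ext _ _ _ _ (primitiveB _ _ _ _ pP (primitive_cst C))) => x _ //;
  ring.
- by split => //; rewrite ?Q0; [ring|rewrite /C divfK ?subrr// gt_eqF].
Qed.

Lemma primitive_le0 F f : primitive F f ->
  {ae mu, forall x, x \in `[0, L] -> f x <= 0} ->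
  forall x y, 0 <= x -> x <= y -> y <= L -> F y <= F x.
Proof.
move=> /primitiveN pF f0 x y x0 xy yL; rewrite -lerN2.
apply: (primitive_ge0 _ _ pF) => //.
by apply: aeS f0 => t f0 /f0; rewrite oppr_ge0.
Qed.

(* The Wronskians of [u] with [sinh (r x)] and [sinh (r (L - x))] are monotone; combining
   their signs gives [r sinh (r L) u(x) >= 0]. *)
Lemma dirichlet_ge0 k u u1 u2 : 0 < k -> primitive u u1 -> primitive u1 u2 ->
  0 <= u 0 -> 0 <= u L ->
  {ae mu, forall x, x \in `[0, L] -> u2 x <= k * u x} ->
  forall x, 0 <= x <= L -> 0 <= u x.
Proof.
move=> k0 pu pu1 u0 uL le2 x /andP[x0 xL]; pose r := Num.sqrt k.
have r0 : 0 < r by rewrite sqrtr_gt0.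
have rr : r ^+ 2 = k by rewrite sqr_sqrtr// ltW.
pose E x := sinh (r * x + 0) * u1 x - r * (cosh (r * x + 0) * u x).
pose E' x := sinh (- r * x + r * L) * u1 x + r * (cosh (- r * x + r * L) * u x).
have pE : primitive E (fun x => sinh (r * x + 0) * (u2 x - k * u x)).
  apply: (primitive_ext _ _ _ _ (primitiveB _ _ _ _ (primitiveM _ _ _ _ (primitive_sinh r
    0) pu1)
    (primitiveZ r _ _ (primitiveM _ _ _ _ (primitive_cosh r 0) pu)))) => t _ //.
  by rewrite -rr; ring.
have pE' : primitive E' (fun x => sinh (- r * x + r * L) * (u2 x - k * u x)).
  apply: (primitive_ext _ _ _ _ (primitiveD _ _ _ _ (primitiveM _ _ _ _ (primitive_sinh
    (- r) (r * L)) pu1)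
    (primitiveZ r _ _ (primitiveM _ _ _ _ (primitive_cosh (- r) (r * L)) pu)))) => t _ //.
  by rewrite -rr; ring.
have Ex : E x <= 0.
  apply: (@le_trans _ _ (E 0)); last first.
    by rewrite /E mulr0 addr0 sinh0 cosh0 mul0r mul1r sub0r oppr_le0 mulr_ge0// ltW.
  apply: (primitive_le0 _ _ pE) => //; apply: aeS le2 => t le2 tL.
  rewrite mulr_ge0_le0 ?subr_le0 ?le2//; move: tL; rewrite in_itv/= => /andP[t0 _].
  by rewrite sinh_ge0// addr0 mulr_ge0// ltW.
have Ex' : 0 <= E' x.
  apply: (@le_trans _ _ (E' L)).
    by rewrite /E' mulNr addNr sinh0 cosh0 mul0r mul1r add0r mulr_ge0// ltW.
  apply: (primitive_le0 _ _ pE') => //; apply: aeS le2 => t le2 tL.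
  rewrite mulr_ge0_le0 ?subr_le0 ?le2//; move: tL; rewrite in_itv/= => /andP[_ tL].
  by rewrite sinh_ge0// mulNr addrC -mulrBr mulr_ge0 ?subr_ge0// ltW.
have sx : 0 <= sinh (r * x + 0) by rewrite sinh_ge0// addr0 mulr_ge0// ltW.
have sLx : 0 <= sinh (- r * x + r * L).
  by rewrite sinh_ge0// mulNr addrC -mulrBr mulr_ge0 ?subr_ge0// ltW.
have sL : 0 < r * sinh (r * L) by rewrite mulr_gt0// sinh_gt0// mulr_gt0.
rewrite -(pmulr_rge0 _ sL).
have -> : r * sinh (r * L) * u x = sinh (r * x + 0) * E' x - sinh (- r * x + r * L) * E x.
  have -> : sinh (r * L) = sinh ((r * x + 0) + (- r * x + r * L)) by congr sinh; ring.
  by rewrite sinhD /E /E'; ring.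
by rewrite subr_ge0 (@le_trans _ _ 0)//; [exact: mulr_ge0_le0|exact: mulr_ge0].
Qed.

(** The limit case [k = 0] of [dirichlet_ge0]: [x] and [L - x] take the place of the hyperbolic
    sines. *)
Lemma concave_ge0 w w1 w2 : primitive w w1 -> primitive w1 w2 -> 0 <= w 0 -> 0 <= w L ->
  {ae mu, forall x, x \in `[0, L] -> w2 x <= 0} ->
  forall x, 0 <= x <= L -> 0 <= w x.
Proof.
move=> pw pw1 w0 wL le2 x /andP[x0 xL].
have pE : primitive (fun x => x * w1 x - w x) (fun x => x * w2 x).
  by apply: (primitive_ext _ _ _ _ (primitiveB _ _ _ _ (primitiveM _ _ _ _ primitive_id
    pw1) pw)) => t _ //; ring.
have pE' : primitive (fun x => (L - x) * w1 x + w x) (fun x => (L - x) * w2 x).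
  apply: (primitive_ext _ _ _ _ (primitiveD _ _ _ _ (primitiveM _ _ _ _
    (primitiveB _ _ _ _ (primitive_cst L) primitive_id) pw1) pw)) => t _ //; ring.
have Ex : x * w1 x - w x <= 0.
  apply: (@le_trans _ _ (0 * w1 0 - w 0)); last lra.
  apply: (primitive_le0 _ _ pE) => //; apply: aeS le2 => t le2 /[dup] tL.
  by rewrite in_itv/= => /andP[t0 _]; rewrite mulr_ge0_le0 ?le2.
have Ex' : 0 <= (L - x) * w1 x + w x.
  apply: (@le_trans _ _ ((L - L) * w1 L + w L)); first lra.
  apply: (primitive_le0 _ _ pE') => //; apply: aeS le2 => t le2 /[dup] tL.
  by rewrite in_itv/= => /andP[_ tl]; rewrite mulr_ge0_le0 ?le2// subr_ge0.
rewrite -(pmulr_rge0 _ L0).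
have -> : L * w x = x * ((L - x) * w1 x + w x) - (L - x) * (x * w1 x - w x) by ring.
by rewrite subr_ge0 (@le_trans _ _ 0)// ?mulr_ge0// mulr_ge0_le0 ?subr_ge0.
Qed.

Lemma primitive_integ F f : primitive F f -> integ L f = F L - F 0.
Proof. by move=> [_ FE]; rewrite (FE L) ?lexx ?ltW// addrAC subrr add0r. Qed.

Lemma eq_integ f g : (forall x, 0 <= x <= L -> f x = g x) -> integ L f = integ L g.
Proof. by move=> fg; apply: eq_Rintegral => x; rewrite inE/= in_itv/= => /fg. Qed.

Lemma eq_ae_integ f g : L1 L f -> L1 L g -> aeEq L f g -> integ L f = integ L g.
Proof. by move=> intf intg fg; apply: eq_ae_Rintegral. Qed.

Lemma integD f g : L1 L f -> L1 L g -> integ L (fun x => f x + g x) = integ L f + integ L g.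
Proof. by move=> intf intg; rewrite /integ RintegralD. Qed.

Lemma integB f g : L1 L f -> L1 L g -> integ L (fun x => f x - g x) = integ L f - integ L g.
Proof. by move=> intf intg; rewrite /integ RintegralB. Qed.

Lemma integZ k f : L1 L f -> integ L (fun x => k * f x) = k * integ L f.
Proof. by move=> intf; rewrite /integ RintegralZl. Qed.

Lemma integ_ge0 f : (forall x, 0 <= x <= L -> 0 <= f x) -> 0 <= integ L f.
Proof. by move=> f0; apply: Rintegral_ge0 => x; rewrite /= in_itv/= => /f0. Qed.

Lemma ae_integ_le f g : L1 L f -> L1 L g ->
  {ae mu, forall x, x \in `[0, L] -> f x <= g x} -> integ L f <= integ L g.
Proof.
move=> intf intg fg; rewrite -subr_ge0 -integB//.
rewrite (primitive_integ _ _ (L1_primitive _ (L1B _ _ intg intf))) subr_ge0.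
apply: (primitive_ge0 _ _ (L1_primitive _ (L1B _ _ intg intf))); rewrite ?lexx ?ltW//.
by apply: aeS fg => x fg xL; rewrite subr_ge0 fg.
Qed.

Lemma integ_le f g : L1 L f -> L1 L g ->
  (forall x, 0 <= x <= L -> f x <= g x) -> integ L f <= integ L g.
Proof. by move=> ? ? fg; apply: ae_integ_le => //; apply: aeW => x; rewrite in_itv/= =>
  /fg. Qed.

Lemma primitive_eq_ae F f g : primitive F f -> L1 L g -> aeEq L f g -> primitive F g.
Proof.
move=> pF intg fg; split=> // x xL; have := primitive_ae _ _ _ _ pF (L1_primitive _ intg)
  fg x xL.
by rewrite set_itv1 Rintegral_set1 subr0 => <-; rewrite addrC subrK.
Qed.

(* Lagrange's identity for the operator [v'''' - k v'']. *)
Lemma adjoint_primitive k v v1 v2 v3 v4 g g1 g2 g3 g4 :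
  primitive v v1 -> primitive v1 v2 -> primitive v2 v3 -> primitive v3 v4 ->
  primitive g g1 -> primitive g1 g2 -> primitive g2 g3 -> primitive g3 g4 ->
  primitive (fun x => g x * v3 x - g1 x * v2 x + g2 x * v1 x - g3 x * v x
                      - k * (g x * v1 x) + k * (g1 x * v x))
            (fun x => g x * (v4 x - k * v2 x) - v x * (g4 x - k * g2 x)).
Proof.
move=> pv pv1 pv2 pv3 pg pg1 pg2 pg3.
have h1 := primitiveM _ _ _ _ pg pv3; have h2 := primitiveM _ _ _ _ pg1 pv2.
have h3 := primitiveM _ _ _ _ pg2 pv1; have h4 := primitiveM _ _ _ _ pg3 pv.
have h5 := primitiveZ k _ _ (primitiveM _ _ _ _ pg pv1).
have h6 := primitiveZ k _ _ (primitiveM _ _ _ _ pg1 pv).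
apply: (primitive_ext _ _ _ _ (primitiveD _ _ _ _ (primitiveB _ _ _ _ (primitiveB _ _ _ _
  (primitiveD _ _ _ _ (primitiveB _ _ _ _ h1 h2) h3) h4) h5) h6)) => x _ //; ring.
Qed.

(** Each boundary term of [adjoint_primitive] contains a factor that vanishes at both ends, so the
    operator is symmetric under the hinged conditions. *)
Lemma beam_duality k v v1 v2 v3 f g g1 g2 g3 h : L1 L f -> L1 L h ->
  beam v v1 v2 v3 (fun x => k * v2 x + f x) ->
  beam g g1 g2 g3 (fun x => k * g2 x + h x) ->
  integ L (fun x => v x * h x) = integ L (fun x => g x * f x).
Proof.
move=> intf inth [pv pv1 pv2 pv3 [v0 vL v20 v2L]] [pg pg1 pg2 pg3 [g0 gL g20 g2L]].
have /primitive_integ := adjoint_primitive k _ _ _ _ _ _ _ _ _ _ pv pv1 pv2 pv3 pg pg1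
  pg2 pg3.
rewrite v0 vL v20 v2L g0 gL g20 g2L => H.
have intgf := L1Ml _ _ (primitive_continuous _ _ pg) intf.
have intvh := L1Ml _ _ (primitive_continuous _ _ pv) inth.
apply/eqP; rewrite eq_sym -subr_eq0 -integB//; apply/eqP.
have -> : integ L (fun x => g x * f x - v x * h x) = integ L
  (fun x => g x * (k * v2 x + f x - k * v2 x) - v x * (k * g2 x + h x - k * g2 x)).
  by apply: eq_integ => x _; ring.
by rewrite H; ring.
Qed.

(** The second-order counterpart: the Wronskian [u h' - h u'] vanishes at both ends. *)
Lemma dirichlet_duality k u u1 f h h1 e : L1 L f -> L1 L e ->
  primitive u u1 -> primitive u1 (fun x => k * u x - f x) -> u 0 = 0 -> u L = 0 ->
  primitive h h1 -> primitive h1 (fun x => k * h x - e x) -> h 0 = 0 -> h L = 0 ->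
  integ L (fun x => u x * e x) = integ L (fun x => h x * f x).
Proof.
move=> intf inte pu pu1 u0 uL ph ph1 h0 hL.
have P := primitiveB _ _ _ _ (primitiveM _ _ _ _ pu ph1) (primitiveM _ _ _ _ ph pu1).
have := primitive_integ _ _ P; rewrite u0 uL h0 hL => H.
have inthf := L1Ml _ _ (primitive_continuous _ _ ph) intf.
have intue := L1Ml _ _ (primitive_continuous _ _ pu) inte.
apply/eqP; rewrite eq_sym -subr_eq0 -integB//; apply/eqP.
have -> : integ L (fun x => h x * f x - u x * e x) = integ L
  (fun x => u1 x * h1 x + u x * (k * h x - e x) - (h1 x * u1 x + h x * (k * u x - f x))).
  by apply: eq_integ => x _; ring.
by rewrite H; ring.
Qed.

Lemma beamB k v v1 v2 v3 f w w1 w2 w3 g :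
  beam v v1 v2 v3 (fun x => k * v2 x + f x) -> beam w w1 w2 w3 (fun x => k * w2 x + g x) ->
  beam (fun x => v x - w x) (fun x => v1 x - w1 x) (fun x => v2 x - w2 x)
    (fun x => v3 x - w3 x) (fun x => k * (v2 x - w2 x) + (f x - g x)).
Proof.
move=> [pv pv1 pv2 pv3 [v0 vL v20 v2L]] [pw pw1 pw2 pw3 [w0 wL w20 w2L]]; split.
- exact: primitiveB.
- exact: primitiveB.
- exact: primitiveB.
- by apply: (primitive_ext _ _ _ _ (primitiveB _ _ _ _ pv3 pw3)) => x _ //; ring.
- by rewrite v0 vL v20 v2L w0 wL w20 w2L !subrr.
Qed.

Lemma beamZ k l v v1 v2 v3 f :
  beam v v1 v2 v3 (fun x => k * v2 x + f x) ->
  beam (fun x => l * v x) (fun x => l * v1 x) (fun x => l * v2 x)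
    (fun x => l * v3 x) (fun x => k * (l * v2 x) + l * f x).
Proof.
move=> [pv pv1 pv2 pv3 [v0 vL v20 v2L]]; split.
- exact: primitiveZ.
- exact: primitiveZ.
- exact: primitiveZ.
- by apply: (primitive_ext _ _ _ _ (primitiveZ l _ _ pv3)) => x _ //; ring.
- by rewrite v0 vL v20 v2L !mulr0.
Qed.

(** * The Green function *)

Lemma green_split a x f : 0 <= x <= L -> {within `[0, L], continuous (green_le L a x)} ->
  {within `[0, L], continuous (green_le L a ^~ x)} -> L1 L f ->
  integ L (fun s => green L a x s * f s) =
  \int[mu]_(s in `[0, x]) (green_le L a s x * f s) +
  \int[mu]_(s in `[x, L]) (green_le L a x s * f s).
Proof.
move=> /andP[x0 xL] cb ca intf.
have inta := L1Ml _ _ ca intf; have intb := L1Ml _ _ cb intf.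
have sub1 : `[0, x]%classic `<=` (`[0, L]%classic : set R) by exact: sub_itv_cc.
have sub2 : `[x, L]%classic `<=` (`[0, L]%classic : set R) by exact: sub_itv_cc.
have sub3 : `]x, L]%classic `<=` (`[0, L]%classic : set R).
  by apply: subset_trans sub2; apply: subset_itvr; rewrite bnd_simp.
have Ea s : s <= x -> green L a x s * f s = green_le L a s x * f s.
  rewrite /green le_eqVlt => /predU1P[->|sx]; first by rewrite lexx.
  by rewrite leNgt sx.
have Eb s : x <= s -> green L a x s * f s = green_le L a x s * f s.
  by rewrite /green => ->.
have E : `[0, L]%classic = `[0, x]%classic `|` `]x, L]%classic :> set R.
  by rewrite -itv_bndbnd_setU// ?bnd_simp.
have int1 : mu.-integrable `[0, x] (EFin \o (fun s => green L a x s * f s)).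
  apply: eq_integrable (L1_itv _ _ _ sub1 inta) => // s; rewrite inE/= in_itv/= =>
    /andP[_ sx].
  by rewrite Ea.
have int2 : mu.-integrable `]x, L] (EFin \o (fun s => green L a x s * f s)).
  apply: eq_integrable (L1_itv _ _ _ sub3 intb) => // s; rewrite inE/= in_itv/= =>
    /andP[xs _].
  by rewrite Eb// ltW.
have disj s : s \in (`[0, x]%classic : set R) -> s \in (`]x, L]%classic : set R) -> False.
  by rewrite !inE/= !in_itv/= => /andP[_ sx] /andP[xs _]; rewrite ltNge sx in xs.
rewrite /integ E Rintegral_setU//; last 2 first.
- have i1 := (@integrable_mkcond _ _ _ mu _ _ (measurable_itv _)).1 int1.
  have i2 := (@integrable_mkcond _ _ _ mu _ _ (measurable_itv _)).1 int2.
  apply: (@integrable_mkcond _ _ _ mu _ _ _).2; first by apply: measurableU; exact: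
    measurable_itv.
  apply: eq_integrable (integrableD measurableT i1 i2) => // s _.
  rewrite /= !patchE in_setU; case: ifPn => s1; case: ifPn => s2 //=.
  + by have := disj _ s1 s2.
  + by rewrite adde0.
  + by rewrite add0e.
  + by rewrite adde0.
- by apply/disj_setPS => s [s1 s2]; apply: (disj s); rewrite inE.
congr (_ + _).
  by apply: eq_Rintegral => s; rewrite inE/= in_itv/= => /andP[_ sx]; exact: Ea.
rewrite -[RHS]Rintegral_itv_obnd_cbnd; last exact: L1_itv.
by apply: eq_Rintegral => s; rewrite inE/= in_itv/= => /andP[xs _]; apply: Eb; exact: ltW.
Qed.

(** Lagrange's identity is applied to [w] and the branch [al] on [[0, x]], then to [w] and the
    branch [be] on [[x, L]]. The terms at 0 and [L] vanish; at [x] the branches agree up to the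
    second derivative, and the unit jump of the third leaves exactly [w x]. *)
Lemma beam_green a w w1 w2 w3 f : 0 < a -> L1 L f ->
  beam w w1 w2 w3 (fun x => a * w2 x + f x) ->
  forall x, 0 <= x <= L -> integ L (fun s => green L a x s * f s) = w x.
Proof.
move=> a0 intf [pw pw1 pw2 pw3 [w0 wL w20 w2L]] x /andP[x0 xL].
pose r := Num.sqrt a.
have r0 : 0 < r by rewrite sqrtr_gt0.
have rr : r ^+ 2 = a by rewrite sqr_sqrtr// ltW.
pose sL := sinh (r * L).
have sL0 : 0 < sL by rewrite sinh_gt0// mulr_gt0.
have ne0 : [/\ a != 0, r != 0, sL != 0 & L != 0] by rewrite !gt_eqF.
have [an rn sn Ln] := ne0.
pose S := sinh (r * (L - x)).
pose al s := green_le L a s x.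
pose al1 s := (L - x) / (a * L) - cosh (r * s + 0) * S / (a * sL).
pose al2 s := - (r * S / (a * sL)) * sinh (r * s + 0).
pose al3 s := - (S / sL) * cosh (r * s + 0).
have pal : primitive al al1.
  apply: (primitive_ext _ _ _ _ (primitiveB _ _ _ _ (primitiveZ ((L - x) / (a * L)) _ _
    primitive_id)
    (primitiveZ (S / (a * r * sL)) _ _ (primitive_sinh r 0)))) => s _.
    by rewrite /al /green_le -/r -/sL -/S addr0; field; rewrite an Ln rn sn.
  by rewrite /al1; field; rewrite an Ln rn sn.
have pal1 : primitive al1 al2.
  apply: (primitive_ext _ _ _ _ (primitiveB _ _ _ _ (primitive_cst ((L - x) / (a * L)))
    (primitiveZ (S / (a * sL)) _ _ (primitive_cosh r 0)))) => s _.
    by rewrite /al1; ring.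
  by rewrite /al2; field; rewrite an sn.
have pal2 : primitive al2 al3.
  apply: (primitive_ext _ _ _ _ (primitiveZ (- (r * S / (a * sL))) _ _ (primitive_sinh r
    0))) => s _ //.
  by rewrite /al3 -rr; field; rewrite rn sn.
have pal3 : primitive al3 (fun s => a * al2 s).
  apply: (primitive_ext _ _ _ _ (primitiveZ (- (S / sL)) _ _ (primitive_cosh r 0))) => s
    _ //.
  by rewrite /al2; field; rewrite an sn.
pose T := sinh (r * x).
pose be s := green_le L a x s.
pose be1 s := - (x / (a * L)) + cosh (- r * s + r * L) * T / (a * sL).
pose be2 s := - (r * T / (a * sL)) * sinh (- r * s + r * L).
pose be3 s := (T / sL) * cosh (- r * s + r * L).
have pbe : primitive be be1.
  apply: (primitive_ext _ _ _ _ (primitiveB _ _ _ _ (primitiveZ (x / (a * L)) _ _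
    (primitiveB _ _ _ _ (primitive_cst L) primitive_id))
    (primitiveZ (T / (a * r * sL)) _ _ (primitive_sinh (- r) (r * L))))) => s _.
    rewrite /be /green_le -/r -/sL -/T (_ : - r * s + r * L = r * (L - s)); last by ring.
    by field; rewrite an Ln rn sn.
  by rewrite /be1; field; rewrite an Ln rn sn.
have pbe1 : primitive be1 be2.
  apply: (primitive_ext _ _ _ _ (primitiveD _ _ _ _ (primitive_cst (- (x / (a * L))))
    (primitiveZ (T / (a * sL)) _ _ (primitive_cosh (- r) (r * L))))) => s _.
    by rewrite /be1; ring.
  by rewrite /be2; field; rewrite an sn.
have pbe2 : primitive be2 be3.
  apply: (primitive_ext _ _ _ _ (primitiveZ (- (r * T / (a * sL))) _ _ (primitive_sinh (-
    r) (r * L)))) => s _ //.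
  by rewrite /be3 -rr; field; rewrite rn sn.
have pbe3 : primitive be3 (fun s => a * be2 s).
  apply: (primitive_ext _ _ _ _ (primitiveZ (T / sL) _ _ (primitive_cosh (- r) (r * L))))
    => s _ //.
  by rewrite /be2; field; rewrite an sn.
rewrite green_split ?x0//; last 2 first.
- exact: primitive_continuous pbe.
- exact: primitive_continuous pal.
have Pa := adjoint_primitive a _ _ _ _ _ _ _ _ _ _ pw pw1 pw2 pw3 pal pal1 pal2 pal3.
have Pb := adjoint_primitive a _ _ _ _ _ _ _ _ _ _ pw pw1 pw2 pw3 pbe pbe1 pbe2 pbe3.
have {}Pa := primitive_ext _ _ _ (fun s => al s * f s) Pa (fun _ _ => erefl)
  (fun s _ => ltac:(ring)).
have {}Pb := primitive_ext _ _ _ (fun s => be s * f s) Pb (fun _ _ => erefl)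
  (fun s _ => ltac:(ring)).
have Ia := primitive_sub _ _ 0 x Pa (lexx 0) x0 xL.
have Ib := primitive_sub _ _ x L Pb x0 xL (lexx L).
have al0 : al 0 = 0 by rewrite /al /green_le !(mulr0, mul0r) sinh0 !mul0r subrr.
have al20 : al2 0 = 0 by rewrite /al2 mulr0 addr0 sinh0 mulr0.
have beL : be L = 0 by rewrite /be /green_le subrr !(mulr0, mul0r) sinh0 !(mulr0, mul0r)
  subrr.
have be2L : be2 L = 0.
  by rewrite /be2 (_ : - r * L + r * L = 0) ?sinh0 ?mulr0//; ring.
(* The addition formula at [L = x + (L - x)] yields both the matching of first derivatives ([e1])
   and the unit jump ([e3]). *)
have sE : sL = T * cosh (r * (L - x)) + cosh (r * x) * S.
  by rewrite -sinhD /sL; congr sinh; ring.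
have e0 : al x = be x by [].
have rE : - r * x + r * L = r * (L - x) by ring.
have e1 : al1 x = be1 x.
  rewrite /al1 /be1 rE addr0; apply/eqP; rewrite -subr_eq0; apply/eqP.
  transitivity ((sL - (T * cosh (r * (L - x)) + cosh (r * x) * S)) / (a * sL)).
    by field; rewrite an Ln sn.
  by rewrite -sE subrr mul0r.
have e2 : al2 x = be2 x by rewrite /al2 /be2 rE addr0 -/S -/T; field; rewrite an sn.
have e3 : be3 x - al3 x = 1.
  rewrite /al3 /be3 rE addr0.
  transitivity ((T * cosh (r * (L - x)) + cosh (r * x) * S) / sL); first by field;
    rewrite sn.
  by rewrite -sE divff.
move: Ia Ib; rewrite /= al0 al20 w0 w20 wL w2L beL be2L e0 e1 e2.
have -> : al3 x = be3 x - 1 by rewrite -e3; ring.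
set I1 := Rintegral _ _ _; set I2 := Rintegral _ _ _ => Ia Ib.
rewrite -/I1 -/I2; lra.
Qed.

(** Any solution is represented by the Green integral of its load, which already determines it. *)
Lemma beam_unique k v v1 v2 v3 w w1 w2 w3 f : 0 < k -> L1 L f ->
  beam v v1 v2 v3 (fun x => k * v2 x + f x) -> beam w w1 w2 w3 (fun x => k * w2 x + f x) ->
  forall x, 0 <= x <= L -> v x = w x.
Proof.
by move=> k0 intf bv bw x xL; rewrite -(beam_green _ _ _ _ _ _ k0 intf bv)// -(beam_green
  _ _ _ _ _ _ k0 intf bw).
Qed.

(** * Responses to the constant load and their dependence on the coefficient *)

Lemma L1_cst (k : R) : L1 L (fun=> k).
Proof. exact/L1_within_continuous/within_continuous_cst. Qed.

(* [kh k] and [kg k] are the responses to the load 1: [- h'' + k h = 1] with [h = 0] at the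
   ends, and [g'''' - k g'' = 1] with [g = g'' = 0] at the ends; moreover [g'' = - h]. *)
Definition kh k x : R :=
  (1 - cosh (Num.sqrt k * x + - (Num.sqrt k * L / 2)) / cosh (Num.sqrt k * L / 2)) / k.
Definition kh1 k x : R :=
  - (Num.sqrt k * sinh (Num.sqrt k * x + - (Num.sqrt k * L / 2)) / cosh (Num.sqrt k * L /
    2)) / k.
Definition kg k x : R := (x * (L - x) / 2 - kh k x) / k.
Definition kg1 k x : R := ((L - 2 * x) / 2 - kh1 k x) / k.

Section comparison.
Context (k : R) (k0 : 0 < k).

Let C_neq0 : cosh (Num.sqrt k * L / 2) != 0. Proof. by rewrite gt_eqF// cosh_gt0. Qed.
Let k_neq0 : k != 0. Proof. by rewrite gt_eqF. Qed.
Let r_neq0 : Num.sqrt k != 0. Proof. by rewrite gt_eqF// sqrtr_gt0. Qed.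
Let rr : Num.sqrt k ^+ 2 = k. Proof. by rewrite sqr_sqrtr// ltW. Qed.

Lemma primitive_kh : primitive (kh k) (kh1 k).
Proof.
apply: (primitive_ext _ _ _ _ (primitiveB _ _ _ _ (primitive_cst k^-1)
  (primitiveZ (k * cosh (Num.sqrt k * L / 2))^-1 _ _ (primitive_cosh (Num.sqrt k) (-
    (Num.sqrt k * L / 2)))))) => x _.
  by rewrite /kh; field; rewrite k_neq0 C_neq0.
by rewrite /kh1; field; rewrite k_neq0 C_neq0.
Qed.

Lemma primitive_kh1 : primitive (kh1 k) (fun x => k * kh k x - 1).
Proof.
apply: (primitive_ext _ _ _ _ (primitiveZ (- (Num.sqrt k / (k * cosh (Num.sqrt k * L /
  2)))) _ _
  (primitive_sinh (Num.sqrt k) (- (Num.sqrt k * L / 2))))) => x _.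
  by rewrite /kh1; field; rewrite k_neq0 C_neq0.
rewrite /kh; set d := cosh (_ * x + _).
transitivity (- (Num.sqrt k ^+ 2 / k) * (d / cosh (Num.sqrt k * L / 2))).
  by field; rewrite k_neq0 C_neq0.
by rewrite rr; field; rewrite k_neq0 C_neq0.
Qed.

Lemma kh0 : kh k 0 = 0.
Proof. by rewrite /kh mulr0 add0r coshN divff// subrr mul0r. Qed.

Lemma khL : kh k L = 0.
Proof. by rewrite /kh (_ : Num.sqrt k * L + - _ = Num.sqrt k * L / 2) ?divff ?subrr
  ?mul0r//; field. Qed.

Lemma kg_beam : beam (kg k) (kg1 k) (fun x => - kh k x) (fun x => - kh1 k x) (fun x => k
  * (- kh k x) + 1).
Proof.
have pq : primitive (fun x => x * (L - x) / 2) (fun x => (L - 2 * x) / 2).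
  by apply: (primitive_ext _ _ _ _ (primitiveZ 2^-1 _ _ (primitiveM _ _ _ _ primitive_id
    (primitiveB _ _ _ _ (primitive_cst L) primitive_id)))) => x _ //; field.
have pq1 : primitive (fun x => (L - 2 * x) / 2) (fun x => -1).
  by apply: (primitive_ext _ _ _ _ (primitiveB _ _ _ _ (primitive_cst (L / 2))
    primitive_id)) => x _ //; field.
split.
- by apply: (primitive_ext _ _ _ _ (primitiveZ k^-1 _ _ (primitiveB _ _ _ _ pq
  primitive_kh))) => x _; rewrite /kg /kg1 mulrC.
- apply: (primitive_ext _ _ _ _ (primitiveZ k^-1 _ _ (primitiveB _ _ _ _ pq1
  primitive_kh1))) => x _.
    by rewrite /kg1 mulrC.
  by field.
- exact: primitiveN primitive_kh.
- by apply: (primitive_ext _ _ _ _ (primitiveN _ _ primitive_kh1)) => x _ //; ring.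
- by rewrite /kg kh0 khL !oppr0; split => //; field.
Qed.

Lemma kh_continuous : {within `[0, L], continuous (kh k)}.
Proof. exact: primitive_continuous primitive_kh. Qed.

Lemma kg_continuous : {within `[0, L], continuous (kg k)}.
Proof. by have [/primitive_continuous] := kg_beam. Qed.

Lemma integ_kh : integ L (kh k) = (L - 2 * tanh (Num.sqrt k * L / 2) / Num.sqrt k) / k.
Proof.
have P : primitive (fun x => (x - sinh (Num.sqrt k * x + - (Num.sqrt k * L / 2))
    / (Num.sqrt k * cosh (Num.sqrt k * L / 2))) / k) (kh k).
  apply: (primitive_ext _ _ _ _ (primitiveZ k^-1 _ _ (primitiveB _ _ _ _ primitive_id
   (primitiveZ (Num.sqrt k * cosh (Num.sqrt k * L / 2))^-1 _ _
     (primitive_sinh (Num.sqrt k) (- (Num.sqrt k * L / 2))))))) => x _.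
    by field; rewrite k_neq0 C_neq0 r_neq0.
  by rewrite /kh; field; rewrite k_neq0 C_neq0 r_neq0.
have rL2 : Num.sqrt k * L + - (Num.sqrt k * L / 2) = Num.sqrt k * L / 2 by field.
have r0 : Num.sqrt k * 0 + - (Num.sqrt k * L / 2) = - (Num.sqrt k * L / 2) by ring.
rewrite (primitive_integ _ _ P) /= rL2 r0 sinhN.
by rewrite /tanh; field; rewrite k_neq0 C_neq0 r_neq0.
Qed.

Lemma integ_kg : integ L (kg k) = (L ^+ 3 / 12 - integ L (kh k)) / k.
Proof.
have pq : primitive (fun x => L * x ^+ 2 / 4 - x ^+ 3 / 6) (fun x => x * (L - x) / 2).
  have p2 := primitiveM _ _ _ _ primitive_id primitive_id.
  apply: (primitive_ext _ _ _ _ (primitiveB _ _ _ _ (primitiveZ (L / 4) _ _ p2)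
    (primitiveZ 6^-1 _ _ (primitiveM _ _ _ _ primitive_id p2)))) => x _; by field.
have E : integ L (kg k) = integ L (fun x => k^-1 * (x * (L - x) / 2 - kh k x)).
  by apply: eq_integ => x _; rewrite /kg mulrC.
have ikh : L1 L (kh k) by exact: L1_within_continuous kh_continuous.
rewrite E integZ; last exact: L1B (primitive_L1 _ _ pq) _.
rewrite integB//; last exact: primitive_L1 pq.
by rewrite (primitive_integ _ _ pq); field.
Qed.

Lemma kh_ge0 x : 0 <= x <= L -> 0 <= kh k x.
Proof.
apply: (dirichlet_ge0 k _ _ _ k0 primitive_kh primitive_kh1); rewrite ?kh0 ?khL//.
by apply: aeW => t _; rewrite lerBlDr lerDl.
Qed.

(** The difference [1/k - h] solves the homogeneous equation and equals [1/k] at both ends. *)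
Lemma kh_le x : 0 <= x <= L -> kh k x <= k^-1.
Proof.
move=> xL; rewrite -subr_ge0; move: x xL.
apply: (dirichlet_ge0 k _ _ _ k0 (primitiveB _ _ _ _ (primitive_cst k^-1) primitive_kh)
  (primitiveB _ _ _ _ (primitive_cst 0) primitive_kh1)); rewrite ?kh0 ?khL ?subr0
    ?invr_ge0 ?ltW//.
by apply: aeW => t _; rewrite mulrBr mulfV//; lra.
Qed.

Lemma kg_ge0 x : 0 <= x <= L -> 0 <= kg k x.
Proof.
have [pg pg1 _ _ [g0 gL _ _]] := kg_beam.
apply: (concave_ge0 _ _ _ pg pg1); rewrite ?g0 ?gL//.
by apply: aeW => t; rewrite in_itv/= oppr_le0 => /kh_ge0.
Qed.

(** Discard [h >= 0] in [k g = x (L - x) / 2 - h]; the parabola peaks at [L / 2] with value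
    [L^2 / 8]. *)
Lemma kg_le x : 0 <= x <= L -> kg k x <= L ^+ 2 / (8 * k).
Proof.
move=> xL; rewrite /kg ler_pdivrMr//.
have -> : L ^+ 2 / (8 * k) * k = L ^+ 2 / 8 by field.
have := kh_ge0 _ xL; have : 0 <= (x - L / 2) ^+ 2 by exact: sqr_ge0.
have -> : (x - L / 2) ^+ 2 = x ^+ 2 - x * L + L ^+ 2 / 4 by field.
have -> : x * (L - x) = x * L - x ^+ 2 by ring.
lra.
Qed.

End comparison.

Section monotonicity.
Context (k k' : R) (k0 : 0 < k) (kk' : k <= k').

Let k'0 : 0 < k'. Proof. exact: lt_le_trans kk'. Qed.

(** With [u = h_k - h_k'], one has [- u'' + k u = (k' - k) h_k' >= 0]. *)
Lemma kh_anti x : 0 <= x <= L -> kh k' x <= kh k x.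
Proof.
move=> xL; rewrite -subr_ge0; move: x xL.
apply: (dirichlet_ge0 k _ _ _ k0 (primitiveB _ _ _ _ (primitive_kh _ k0) (primitive_kh _
  k'0))
  (primitiveB _ _ _ _ (primitive_kh1 _ k0) (primitive_kh1 _ k'0))); rewrite ?kh0 ?khL
    ?subrr//.
apply: aeW => t; rewrite in_itv/= => /(kh_ge0 _ k'0) h0.
have : 0 <= (k' - k) * kh k' t by rewrite mulr_ge0 ?subr_ge0.
by rewrite mulrBr mulrBl; lra.
Qed.

(** With [u = k' h_k' - k h_k], one has [- u'' + k' u = (k' - k) (1 - k h_k)], nonnegative by
    [kh_le]. *)
Lemma kkh_mono x : 0 <= x <= L -> k * kh k x <= k' * kh k' x.
Proof.
move=> xL; rewrite -subr_ge0; move: x xL.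
apply: (dirichlet_ge0 k' _ _ _ k'0 (primitiveB _ _ _ _ (primitiveZ k' _ _ (primitive_kh _
  k'0)) (primitiveZ k _ _ (primitive_kh _ k0)))
  (primitiveB _ _ _ _ (primitiveZ k' _ _ (primitive_kh1 _ k'0)) (primitiveZ k _ _
    (primitive_kh1 _ k0)))); rewrite ?kh0 ?khL ?mulr0 ?subrr//.
apply: aeW => t; rewrite in_itv/= => /(kh_le _ k0) h1.
have h2 : 0 <= (k' - k) * (1 - k * kh k t).
  by rewrite mulr_ge0 ?subr_ge0// (le_trans (ler_wpM2l (ltW k0) h1))// mulfV// gt_eqF.
rewrite -subr_ge0 (_ : _ - _ = (k' - k) * (1 - k * kh k t))//; ring.
Qed.

(** Since [g'' = - h], comparing the [h] makes the difference of the [g] concave with zero end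
    values; [kkg_mono] follows from [kkh_mono] in the same way. *)
Lemma kg_anti x : 0 <= x <= L -> kg k' x <= kg k x.
Proof.
move=> xL; rewrite -subr_ge0; move: x xL.
have [pg pg1 _ _ [g0 gL _ _]] := kg_beam _ k0.
have [pg' pg1' _ _ [g0' gL' _ _]] := kg_beam _ k'0.
apply: (concave_ge0 _ _ _ (primitiveB _ _ _ _ pg pg') (primitiveB _ _ _ _ pg1 pg1'));
  rewrite ?g0 ?gL ?g0' ?gL' ?subrr//.
by apply: aeW => t; rewrite in_itv/= => /kh_anti; lra.
Qed.

Lemma kkg_mono x : 0 <= x <= L -> k * kg k x <= k' * kg k' x.
Proof.
move=> xL; rewrite -subr_ge0; move: x xL.
have [pg pg1 _ _ [g0 gL _ _]] := kg_beam _ k0.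
have [pg' pg1' _ _ [g0' gL' _ _]] := kg_beam _ k'0.
apply: (concave_ge0 _ _ _ (primitiveB _ _ _ _ (primitiveZ k' _ _ pg') (primitiveZ k _ _ pg))
  (primitiveB _ _ _ _ (primitiveZ k' _ _ pg1') (primitiveZ k _ _ pg1)));
  rewrite ?g0 ?gL ?g0' ?gL' ?mulr0 ?subrr//.
by apply: aeW => t; rewrite in_itv/= => /kkh_mono; lra.
Qed.

End monotonicity.

Lemma integ_kg_ge0 k : 0 < k -> 0 <= integ L (kg k).
Proof. by move=> k0; apply: integ_ge0 => x; exact: kg_ge0. Qed.

Lemma powR52 (a : R) : 0 < a -> a `^ (5 / 2) = a ^+ 2 * Num.sqrt a.
Proof.
move=> a0; have -> : 5 / 2 = 2%:R + 2^-1 :> R by field.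
rewrite powRD; last by rewrite (gt_eqF a0) implybT.
by rewrite powR_mulrn ?ltW// powR12_sqrt// ltW.
Qed.

Lemma constME a c : 0 < a -> constM L a c = 1 + c * integ L (kg a).
Proof.
move=> a0; rewrite /constM powR52// integ_kg// integ_kh//.
have r0 : Num.sqrt a != 0 by rewrite gt_eqF// sqrtr_gt0.
by field; rewrite r0 gt_eqF.
Qed.

(** The form in which [N] is met later: a root [z] of the scalar equation is at most
    [(L^2 / 8) \int p / (a M)], and the term [c z \int h_a] then contributes the difference
    [N - M]. *)
Lemma constNE a c : 0 < a -> constN L a c = constM L a c + c * (L ^+ 2 / 8) * integ L (kh
  a).
Proof.
move=> a0; rewrite /constN /constM powR52// integ_kh//.
have r0 : Num.sqrt a != 0 by rewrite gt_eqF// sqrtr_gt0.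
have rr : Num.sqrt a ^+ 2 = a by rewrite sqr_sqrtr// ltW.
by field; rewrite r0 gt_eqF.
Qed.

(** * The solution operator S *)

Section opS.
Context (a c : R) (a0 : 0 < a) (c0 : 0 < c).

Lemma M_ge1 : 1 <= constM L a c.
Proof. by rewrite constME// lerDl mulr_ge0 ?integ_kg_ge0// ltW. Qed.

(** By superposition [w = v - c z g_a], where [v] is the response to [phi] without the nonlocal
    term. Integrating gives [z (1 + c \int g_a) = \int v], and eliminating [z] produces the formula
    of [opS]. *)
Lemma beam_opS w w1 w2 w3 phi : L1 L phi ->
  beam w w1 w2 w3 (fun x => a * w2 x + (phi x - c * integ L w)) ->
  forall x, 0 <= x <= L -> opS L a c phi x = w x.
Proof.
move=> intphi bw x xL.
have [v [v1 [v2 [v3 bv]]]] := beam_exists a phi a0 intphi.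
have vE := beam_green _ _ _ _ _ _ a0 intphi bv.
have bg := kg_beam a a0.
have gE t : 0 <= t <= L -> integ L (green L a t) = kg a t.
  move=> tL; rewrite -(beam_green _ _ _ _ _ _ a0 (L1_cst 1) bg)//.
  by apply: eq_integ => s _; rewrite mulr1.
have [pv _ _ _ _] := bv; have [pg _ _ _ _] := bg.
have intv : L1 L v by exact: L1_within_continuous (primitive_continuous _ _ pv).
have intg : L1 L (kg a) by exact: L1_within_continuous (primitive_continuous _ _ pg).
set z := integ L w in bw *.
have wE t : 0 <= t <= L -> w t = v t - c * z * kg a t.
  have B := beamB _ _ _ _ _ _ _ _ _ _ _ bv (beamZ _ (c * z) _ _ _ _ _ bg).
  rewrite mulr1 in B; apply: (beam_unique _ _ _ _ _ _ _ _ _ _ a0 _ bw B).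
  by apply: L1B => //; exact: L1_cst.
have zE : z = integ L v - c * z * integ L (kg a).
  by rewrite {1}/z (eq_integ _ _ wE) integB ?integZ//; exact: L1Zl.
have M0 : 1 + c * integ L (kg a) != 0.
  by rewrite -constME// gt_eqF// (lt_le_trans _ M_ge1).
rewrite /opS vE// gE// (eq_integ _ _ vE) (eq_integ _ _ gE) wE//.
have -> : integ L v = z + c * z * integ L (kg a) by rewrite {1}zE subrK.
by field.
Qed.

Lemma opS_beam phi : L1 L phi -> exists w w1 w2 w3,
  beam w w1 w2 w3 (fun x => a * w2 x + (phi x - c * integ L w)).
Proof.
move=> intphi.
have [v [v1 [v2 [v3 bv]]]] := beam_exists a phi a0 intphi.
have bg := kg_beam a a0.
have [pv _ _ _ _] := bv; have [pg _ _ _ _] := bg.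
have intv : L1 L v by exact: L1_within_continuous (primitive_continuous _ _ pv).
have intg : L1 L (kg a) by exact: L1_within_continuous (primitive_continuous _ _ pg).
have M0 : 1 + c * integ L (kg a) != 0.
  by rewrite -constME// gt_eqF// (lt_le_trans _ M_ge1).
(* [l] stands for [c] times the integral of the solution; it is the root of
   [l = c (\int v - l \int g_a)]. *)
pose l := c * integ L v / (1 + c * integ L (kg a)).
have zE : c * integ L (fun x => v x - l * kg a x) = l.
  by rewrite integB ?integZ//; [rewrite /l; field|exact: L1Zl].
have B := beamB _ _ _ _ _ _ _ _ _ _ _ bv (beamZ _ l _ _ _ _ _ bg).
rewrite mulr1 in B.
exists (fun x => v x - l * kg a x), (fun x => v1 x - l * kg1 a x),
  (fun x => v2 x - l * - kh a x), (fun x => v3 x - l * - kh1 a x).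
by rewrite zE.
Qed.

End opS.

(** * The scalar equation for the integral of the solution *)

Lemma lipschitz_continuous (f : R -> R) (K : R) : 0 < K ->
  (forall x y, x <= y -> `|f x - f y| <= K * (y - x)) -> continuous f.
Proof.
move=> K0 fK x; apply/cvgrPdist_lt => e e0; near=> y.
have xy : `|x - y| < e / K by near: y; apply: cvgr_dist_lt; [exact: cvg_id|exact: divr_gt0].
have fxy : `|f x - f y| <= K * `|x - y|.
  have [yx|/ltW xy'] := leP y x.
    by rewrite distrC (ger0_norm (_ : 0 <= x - y)) ?subr_ge0//; exact: fK.
  by rewrite [`|x - y|]distrC (ger0_norm (_ : 0 <= y - x)) ?subr_ge0//; exact: fK.
by rewrite (le_lt_trans fxy)// mulrC -ltr_pdivlMr.
Unshelve. all: end_near. Qed.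

Section load.
Context (q : R -> R) (intq : L1 L q) (q0 : {ae mu, forall x, x \in `[0, L] -> 0 <= q x}).

Definition kgload k := integ L (fun x => kg k x * q x).

Lemma L1_kgload k : 0 < k -> L1 L (fun x => kg k x * q x).
Proof. by move=> k0; apply: L1Ml => //; exact: kg_continuous. Qed.

Lemma kgload_anti k k' : 0 < k -> k <= k' -> kgload k' <= kgload k.
Proof.
move=> k0 kk'; have k'0 := lt_le_trans k0 kk'.
apply: ae_integ_le; [exact: L1_kgload..|].
apply: aeS q0 => x q0x /[dup] xL; rewrite in_itv/= => xL'.
by rewrite ler_wpM2r ?q0x// kg_anti.
Qed.

Lemma kgload_mono k k' : 0 < k -> k <= k' -> k * kgload k <= k' * kgload k'.
Proof.
move=> k0 kk'; have k'0 := lt_le_trans k0 kk'.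
rewrite -!integZ; [|exact: L1_kgload..].
apply: ae_integ_le; [apply: L1Zl; exact: L1_kgload..|].
apply: aeS q0 => x q0x /[dup] xL; rewrite in_itv/= => xL'.
have := kkg_mono _ _ k0 kk' x xL'; rewrite !mulrA; apply: ler_wpM2r; exact: q0x.
Qed.

Lemma kgload_ge0 k : 0 < k -> 0 <= kgload k.
Proof.
move=> k0; have E : 0 = integ L (fun=> 0) by rewrite /integ Rintegral_cst// mul0r.
rewrite E; apply: ae_integ_le; [exact: L1_cst|exact: L1_kgload|].
apply: aeS q0 => x q0x /[dup] xL; rewrite in_itv/= => xL'.
by rewrite mulr_ge0 ?q0x// kg_ge0.
Qed.

(** [Num.max z 0] keeps the coefficient at least [a] on the whole line. For [k1 <= k2] with loads
    [J1], [J2], the two monotonicities give [0 <= k1 (J1 - J2) <= (k2 - k1) J2], a Lipschitz bound;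
    the summand 1 in [K] makes it strictly positive. *)
Lemma kgload_continuous (a b : R) : 0 < a -> 0 < b ->
  continuous (fun z : R => kgload (a + b * Num.max z 0)).
Proof.
move=> a0 b0; pose K := b / a * kgload a + 1.
have bm z : 0 <= b * Num.max z 0.
  by apply: mulr_ge0; [exact: ltW|rewrite le_max lexx orbT].
apply: (lipschitz_continuous _ K) => [|x y xy].
  by rewrite ltr_wpDl// mulr_ge0 ?kgload_ge0// divr_ge0 ?ltW.
pose k1 := a + b * Num.max x 0; pose k2 := a + b * Num.max y 0.
have ak1 : a <= k1 by rewrite lerDl.
have k10 : 0 < k1 by exact: lt_le_trans ak1.
have mxy : Num.max x 0 <= Num.max y 0 <= Num.max x 0 + (y - x).
  by case: (leP x 0) => ?; case: (leP y 0) => ?; apply/andP; split; lra.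
have k12 : k1 <= k2 by rewrite lerD2l ler_pM2l//; case/andP: mxy.
have k20 : 0 < k2 by exact: lt_le_trans k12.
have J21 := kgload_anti _ _ k10 k12.
have J12 := kgload_mono _ _ k10 k12.
have J2a := kgload_anti _ _ a0 (le_trans ak1 k12).
have J20 := kgload_ge0 _ k20.
rewrite -/k1 -/k2 ger0_norm ?subr_ge0//.
have step1 : a * (kgload k1 - kgload k2) <= (k2 - k1) * kgload k2.
  apply: (@le_trans _ _ (k1 * (kgload k1 - kgload k2))); last by lra.
  by rewrite ler_wpM2r// subr_ge0.
have step2 : (k2 - k1) * kgload k2 <= (b * (y - x)) * kgload a.
  apply: ler_pM => //; first by rewrite subr_ge0.
  have -> : k2 - k1 = b * (Num.max y 0 - Num.max x 0) by rewrite /k1 /k2; ring.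
  by rewrite ler_pM2l//; case/andP: mxy => _; lra.
rewrite -(ler_pM2l a0) (le_trans (le_trans step1 step2))//.
have -> : a * (K * (y - x)) = b * (y - x) * kgload a + a * (y - x).
  by rewrite /K; field; rewrite gt_eqF.
by rewrite lerDl mulr_ge0 ?subr_ge0// ltW.
Qed.

Lemma kgload_le k : 0 < k -> kgload k <= L ^+ 2 / (8 * k) * integ L q.
Proof.
move=> k0; rewrite -integZ//; apply: ae_integ_le; [exact: L1_kgload|exact: L1Zl|].
apply: aeS q0 => x q0x /[dup] xL; rewrite in_itv/= => xL'.
by rewrite ler_wpM2r ?q0x// kg_le.
Qed.

End load.

Lemma kgload1 k : kgload (fun=> 1) k = integ L (kg k).
Proof. by apply: eq_integ => x _; rewrite mulr1. Qed.

Lemma ae1_ge0 : {ae mu, forall x : R, x \in `[0, L] -> 0 <= (fun=> 1 : R) x}.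
Proof. by apply: aeW => x _; exact: ler01. Qed.

Section scalar_equation.
Context (a b c : R) (p : R -> R) (a0 : 0 < a) (b0 : 0 < b) (c0 : 0 < c).
Context (intp : L1 L p) (p0 : {ae mu, forall x, x \in `[0, L] -> 0 <= p x}).

(* Obtained by testing [w'''' - (a + b z) w'' = p - c z], [z = \int w], against
   [kg (a + b z)]. *)
Definition mean_equation z :=
  z * (1 + c * integ L (kg (a + b * z))) = kgload p (a + b * z).

(** Intermediate values on [[0, Z]] with [Z = \int g_a p]: at [Z] the left side is at least [Z],
    while the right side is at most [Z] because [g_k] decreases with [k]. *)
Lemma mean_equation_exists : exists2 z, 0 <= z & mean_equation z.
Proof.
have i1 := L1_cst 1.
pose Phi z := z * (1 + c * kgload (fun=> 1) (a + b * Num.max z 0)) - kgload p (a + b *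
  Num.max z 0).
have cPhi : continuous Phi.
  move=> z; apply: cvgB; last exact: (kgload_continuous p).
  apply: cvgM; first exact: cvg_id.
  apply: cvgD; first exact: cvg_cst.
  by apply: cvgMl_tmp; exact: (kgload_continuous _ i1 ae1_ge0).
pose Z := kgload p a.
have Z0 : 0 <= Z by exact: kgload_ge0.
have P0 : Phi 0 <= 0 by rewrite /Phi mul0r sub0r oppr_le0 max_l// mulr0 addr0.
have PZ : 0 <= Phi Z.
  rewrite /Phi max_l// subr_ge0.
  have k0 : 0 < a + b * Z by rewrite ltr_pwDl// mulr_ge0// ltW.
  apply: (@le_trans _ _ Z); first by apply: kgload_anti; rewrite ?lerDl ?mulr_ge0// ltW.
  by rewrite ler_peMr// lerDl mulr_ge0 ?(ltW c0)// kgload1 integ_kg_ge0.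
have [||z zZ Pz] := @IVT _ Phi 0 Z 0 Z0.
- exact: continuous_subspaceT.
- by rewrite ge_min le_max P0 PZ orbT.
move: zZ; rewrite in_itv/= => /andP[z0 _]; exists z => //.
move: Pz; rewrite /Phi max_l// kgload1 => /eqP; rewrite subr_eq0 => /eqP.
by [].
Qed.

(** For [k = a + b z], write [z \int g_k = (z / k) (k \int g_k)]: both factors are nondecreasing in
    [z >= 0], so the left side of the equation is strictly increasing, whereas [\int g_k p] is
    nonincreasing. The quotient is handled as [x k2 <= y k1]. *)
Lemma mean_equation_unique z z' : 0 <= z -> 0 <= z' -> mean_equation z -> mean_equation
  z' -> z = z'.
Proof.
have H x y : 0 <= x -> x < y -> mean_equation x -> mean_equation y -> False.
  move=> x0 xy Ex Ey; have y0 := le_lt_trans x0 xy.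
  pose k1 := a + b * x; pose k2 := a + b * y.
  have k10 : 0 < k1 by rewrite ltr_pwDl// mulr_ge0// ltW.
  have k12 : k1 <= k2 by rewrite lerD2l ler_pM2l// ltW.
  have k20 : 0 < k2 by exact: lt_le_trans k12.
  have J := kgload_anti _ intp p0 _ _ k10 k12.
  have H := kgload_mono _ (L1_cst 1) ae1_ge0 _ _ k10 k12.
  rewrite !kgload1 in H.
  have H1 := integ_kg_ge0 _ k10.
  move: Ex Ey; rewrite /mean_equation -/k1 -/k2 => Ex Ey.
  have xHyH : x * integ L (kg k1) <= y * integ L (kg k2).
    rewrite -(ler_pM2l (mulr_gt0 k10 k20)).
    have -> : k1 * k2 * (x * integ L (kg k1)) = (x * k2) * (k1 * integ L (kg k1)) by ring.
    have -> : k1 * k2 * (y * integ L (kg k2)) = (y * k1) * (k2 * integ L (kg k2)) by ring.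
    apply: ler_pM => //; [by rewrite mulr_ge0// ltW|by rewrite mulr_ge0// ltW|].
    rewrite /k1 /k2 !mulrDr (mulrCA x) (mulrCA y) (mulrC y x) lerD2r.
    by rewrite ler_pM2r// ltW.
  have : c * (x * integ L (kg k1)) <= c * (y * integ L (kg k2)) by rewrite ler_pM2l.
  by move: Ex Ey J; rewrite !mulrDr !mulr1 !(mulrCA _ c); lra.
move=> z0 z'0 Ez Ez'; have [zz|zz|//] := ltgtP z z'.
- by have := H _ _ z0 zz Ez Ez'.
- by have := H _ _ z'0 zz Ez' Ez.
Qed.

(** Multiplying the equation by [k] lets [k g_k <= L^2 / 8] bound the right side, while
    [k (1 + c \int g_k)] is at least its value [a M] at [k = a]. *)
Lemma mean_equation_le z : 0 <= z -> mean_equation z ->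
  z * (a * constM L a c) <= L ^+ 2 / 8 * integ L p.
Proof.
move=> z0; rewrite /mean_equation; set k := a + b * z => Ez.
have ak : a <= k by rewrite lerDl mulr_ge0// ltW.
have k0 : 0 < k by exact: lt_le_trans ak.
have := kgload_mono _ (L1_cst 1) ae1_ge0 _ _ a0 ak; rewrite !kgload1 => H.
have le := kgload_le _ intp p0 _ k0; rewrite -Ez -(ler_pM2l k0) in le; move: le.
have -> : k * (L ^+ 2 / (8 * k) * integ L p) = L ^+ 2 / 8 * integ L p.
  by field; rewrite gt_eqF.
apply: le_trans; rewrite constME//.
have -> : k * (z * (1 + c * integ L (kg k))) = z * (k + c * (k * integ L (kg k))) by ring.
have -> : z * (a * (1 + c * integ L (kg a))) = z * (a + c * (a * integ L (kg a))) by ring.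
by rewrite ler_wpM2l// lerD// ler_pM2l.
Qed.

End scalar_equation.

(** * Solutions in W^{4,1} *)

Lemma primitive_agree_derive F f G : primitive F f -> {within `[0, L], continuous f} ->
  (forall x, x \in `]0, L[ -> G x = F x) ->
  forall x, x \in `]0, L[ -> derivable G x 1 /\ derive1 G x = f x.
Proof.
move=> pF cf GF x xL; have [dF <-] := primitive_derive _ _ _ pF cf xL.
have FG : \near x, F x = G x.
  have := near_in_itvoo xL; apply: filterS => y yL; by rewrite GF.
by split; [exact: near_eq_derivable FG dF|rewrite (near_derive1 _ _ _ FG)].
Qed.

Lemma beam_derive1n w w1 w2 w3 w4 W : beam w w1 w2 w3 w4 ->
  (forall x, 0 <= x <= L -> W x = w x) ->
  [/\ forall k x, (k < 3)%N -> x \in `]0, L[ -> derivable (derive1n k W) x 1,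
      forall x, x \in `]0, L[ -> derive1n 2 W x = w2 x
    & forall x, x \in `]0, L[ -> derive1n 3 W x = w3 x].
Proof.
move=> [pw pw1 pw2 pw3 _] WE.
have W0 x : x \in `]0, L[ -> W x = w x.
  by rewrite in_itv/= => /andP[? ?]; apply: WE; rewrite !ltW.
have H1 := primitive_agree_derive _ _ _ pw (primitive_continuous _ _ pw1) W0.
have H2 := primitive_agree_derive _ _ _ pw1 (primitive_continuous _ _ pw2) (fun x xL =>
  (H1 x xL).2).
have H3 := primitive_agree_derive _ _ _ pw2 (primitive_continuous _ _ pw3) (fun x xL =>
  (H2 x xL).2).
split.
- move=> [|[|[|]]]// x _ xL; [exact: (H1 x xL).1|exact: (H2 x xL).1|exact: (H3 x xL).1].
- by move=> x xL; exact: (H2 x xL).2.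
- by move=> x xL; exact: (H3 x xL).2.
Qed.

Lemma beam_bvp a b c p w w1 w2 w3 W :
  beam w w1 w2 w3 (fun x => (a + b * integ L w) * w2 x + (p x - c * integ L w)) ->
  (forall x, 0 <= x <= L -> W x = w x) -> bvp_solution L a b c p W.
Proof.
move=> bw WE; have [dW W2 W3] := beam_derive1n _ _ _ _ _ _ bw WE.
have [pw pw1 pw2 pw3 [w0 wL w20 w2L]] := bw.
have [_ w2r w2l] := (continuous_within_itvP _ L0).1 (primitive_continuous _ _ pw2).
have zE : integ L W = integ L w by exact: eq_integ.
split.
- split.
  + apply: subspace_eq_continuous (primitive_continuous _ _ pw) => x.
    by rewrite inE/= in_itv/= => xL; apply/esym/WE.
  + exact: dW.
  + move=> e /(primitive_abs_continuous _ _ pw3)[d d0 H]; exists d => // n u v uv tI sd.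
    have := H n u v uv tI sd; congr (_ < _); apply: eq_bigr => i _.
    by have [ui vi _] := uv i; rewrite !W3.
- apply: aeS (primitive_FTC1 _ _ pw3) => x H xL; have [_ HE] := H xL.
  have -> : derive1n 4 W x = derive1 w3 x.
    apply: near_derive1; have := near_in_itvoo xL; apply: filterS => y yL.
    exact: W3.
  by rewrite HE W2// zE; ring.
- by rewrite !WE ?lexx ?ltW.
- split.
  + rewrite w20 in w2r; apply: cvg_trans w2r; apply: near_eq_cvg; near=> y.
    by apply/esym/W2; rewrite in_itv/=; apply/andP; split; near: y; [exact:
      nbhs_right_gt|exact: nbhs_right_lt].
  + rewrite w2L in w2l; apply: cvg_trans w2l; apply: near_eq_cvg; near=> y.
    by apply/esym/W2; rewrite in_itv/=; apply/andP; split; near: y; [exact: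
      nbhs_left_gt|exact: nbhs_left_lt].
Unshelve. all: end_near. Qed.

(** [G] may be arbitrary at 0 and [L], so the constant of integration is fixed at the midpoint;
    integrability of [q] up to the ends provides the extension. *)
Lemma primitive_extend G q : L1 L q ->
  (forall x y, 0 < x -> x <= y -> y < L -> G y = G x + \int[mu]_(t in `[x, y]) q t) ->
  exists2 F, primitive F q & forall x, x \in `]0, L[ -> F x = G x.
Proof.
move=> intq GE; have pQ := L1_primitive _ intq; set Q := (Q in primitive Q _) in pQ.
pose m := L / 2.
exists (fun x => (G m - Q m) + Q x).
  by apply: (primitive_ext _ _ _ _ (primitiveD _ _ _ _ (primitive_cst (G m - Q m)) pQ))
    => x _ //; ring.
move=> x; rewrite in_itv/= => /andP[x0 xL]; have mE : m = L / 2 by [].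
have [xm|/ltW mx] := leP x m.
  by rewrite (GE x m)// ?(primitive_sub _ _ x m pQ)//; lra.
by rewrite (GE m x)// ?(primitive_sub _ _ m x pQ)//; lra.
Qed.

Lemma derive_extend G f : {within `[0, L], continuous f} ->
  (forall x, x \in `]0, L[ -> derivable G x 1 /\ derive1 G x = f x) ->
  exists2 F, primitive F f & forall x, x \in `]0, L[ -> F x = G x.
Proof.
move=> cf dG; apply: primitive_extend; first exact: L1_within_continuous.
move=> x y x0; rewrite le_eqVlt => /predU1P[<- _|xy yL].
  by rewrite set_itv1 Rintegral_set1 addr0.
have sub : `[x, y]%classic `<=` (`[0, L]%classic : set R) by apply: sub_itv_cc; exact: ltW.
have dGi t : x <= t -> t <= y -> derivable G t 1 /\ derive1 G t = f t.
  by move=> xt ty; apply: dG; rewrite in_itv/= (lt_le_trans x0 xt) (le_lt_trans ty yL).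
have cG t : x <= t -> t <= y -> {for t, continuous G}.
  by move=> xt ty; apply/differentiable_continuous/derivable1_diffP; exact: (dGi t xt ty).1.
rewrite /Rintegral (@continuous_FTC2 _ f G x y)//=; last 3 first.
- exact: continuous_subspaceW cf.
- split.
  + by move=> t; rewrite in_itv/= => /andP[xt ty]; apply: (dGi t _ _).1; exact: ltW.
  + by apply: cvg_at_right_filter; apply: cG => //; exact: ltW.
  + by apply: cvg_at_left_filter; apply: cG => //; exact: ltW.
- by move=> t; rewrite in_itv/= => /andP[xt ty]; apply: (dGi t _ _).2; exact: ltW.
by rewrite addrCA subrr addr0.
Qed.

(** The equation expresses [w''''] through [w''], which is continuous up to the ends, and [p]; hence
    it is integrable. Absolute continuity then makes [w'''] a primitive, and the chain is rebuilt
    downwards, each level extending continuously to [[0, L]]. *)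
Lemma bvp_beam a b c p v : L1 L p -> bvp_solution L a b c p v ->
  exists w w1 w2 w3,
    beam w w1 w2 w3 (fun x => (a + b * integ L w) * w2 x + (p x - c * integ L w)) /\
    forall x, 0 <= x <= L -> v x = w x.
Proof.
move=> intp [[cv dv acv] ev [v0 vL] [v2r v2l]].
set z := integ L v in ev.
(* The value 0 off the open interval is the limit of [w''] prescribed at both ends, so [u2] is
   continuous on [[0, L]]. *)
pose u2 x := if x \in `]0, L[ then derive1n 2 v x else 0.
have u2E x : x \in `]0, L[ -> u2 x = derive1n 2 v x by rewrite /u2 => ->.
have u20 : u2 0 = 0 by rewrite /u2 in_itv/= ltxx.
have u2L : u2 L = 0 by rewrite /u2 in_itv/= ltxx andbF.
have cu2 : {within `[0, L], continuous u2}.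
  apply/(continuous_within_itvP _ L0); split.
  - move=> x xL; have cd : {for x, continuous (derive1n 2 v)}.
      by apply/differentiable_continuous/derivable1_diffP; exact: dv.
    rewrite /continuous_at u2E//; apply: cvg_trans cd; apply: near_eq_cvg.
    by have := near_in_itvoo xL; apply: filterS => y yL; rewrite u2E.
  - rewrite u20; apply: cvg_trans v2r; apply: near_eq_cvg; near=> y.
    by apply/esym/u2E; rewrite in_itv/=; apply/andP; split; near: y; [exact:
      nbhs_right_gt|exact: nbhs_right_lt].
  - rewrite u2L; apply: cvg_trans v2l; apply: near_eq_cvg; near=> y.
    by apply/esym/u2E; rewrite in_itv/=; apply/andP; split; near: y; [exact:
      nbhs_left_gt|exact: nbhs_left_lt].
pose q x := (a + b * z) * u2 x + (p x - c * z).
have intq : L1 L q.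
  apply: L1D; first exact/L1Zl/L1_within_continuous.
  by apply: L1B => //; exact: L1_cst.
have [F3 pF3 F3E] : exists2 F, primitive F q & forall x, x \in `]0, L[ -> F x = derive1n
  3 v x.
  apply: primitive_extend => //; apply: abs_continuous_FTC => //.
  apply: aeS ev => x ev xL.
  by rewrite /q u2E// -(ev xL) addrK addrC subrK.
have dv' k x : (k < 3)%N -> x \in `]0, L[ -> derivable (derive1n k v) x 1 /\ derive1
  (derive1n k v) x = derive1n k.+1 v x.
  by move=> k3 xL; split => //; exact: dv.
have [F2 pF2 F2E] : exists2 F, primitive F F3 & forall x, x \in `]0, L[ -> F x = derive1n
  2 v x.
  apply: derive_extend; first exact: primitive_continuous pF3.
  by move=> x xL; rewrite F3E//; exact: dv'.
have [F1 pF1 F1E] : exists2 F, primitive F F2 & forall x, x \in `]0, L[ -> F x = derive1n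
  1 v x.
  apply: derive_extend; first exact: primitive_continuous pF2.
  by move=> x xL; rewrite F2E//; exact: dv'.
have [F0 pF0 F0E] : exists2 F, primitive F F1 & forall x, x \in `]0, L[ -> F x = v x.
  apply: derive_extend; first exact: primitive_continuous pF1.
  by move=> x xL; rewrite F1E//; exact: (dv' 0%N).
have vF x : 0 <= x <= L -> v x = F0 x.
  apply: eq_within_continuous => //; first exact: primitive_continuous pF0.
  by move=> t tL; rewrite F0E.
have u2F x : 0 <= x <= L -> u2 x = F2 x.
  apply: eq_within_continuous => //; first exact: primitive_continuous pF2.
  by move=> t tL; rewrite F2E// u2E.
have zE : integ L F0 = z by apply/esym/eq_integ.
have LL : 0 <= L <= L by rewrite lexx ltW.
have LL0 : 0 <= (0 : R) <= L by rewrite lexx ltW.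
have pF3' : primitive F3 (fun x => (a + b * z) * F2 x + (p x - c * z)).
  by apply: (primitive_ext _ _ _ _ pF3) => [x _|x xL]; [by []|rewrite /q u2F].
exists F0, F1, F2, F3; split; last exact: vF.
rewrite zE; split; [exact: pF0|exact: pF1|exact: pF2|exact: pF3'|split].
- exact: etrans (esym (vF _ LL0)) v0.
- exact: etrans (esym (vF _ LL)) vL.
- exact: etrans (esym (u2F _ LL0)) u20.
- exact: etrans (esym (u2F _ LL)) u2L.
Unshelve. all: end_near. Qed.

(** The two end points are null. Needed because [opA] involves [derive1n 2], which is controlled
    only inside. *)
Lemma aeW_oo (P : R -> Prop) : (forall x, x \in `]0, L[ -> P x) ->
  {ae mu, forall x, x \in `[0, L] -> P x}.
Proof.
move=> H; exists ([set 0] `|` [set L]); split.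
- by apply: measurableU; exact: measurable_set1.
- have e0 : mu [set 0] = 0%E by exact: lebesgue_measure_set1.
  have eL : mu [set L] = 0%E by exact: lebesgue_measure_set1.
  have le0 : (mu ([set 0%R] `|` [set L])%classic <= mu [set 0%R] + mu [set L])%E.
    exact: (measureU2 mu (measurable_set1 0) (measurable_set1 L)).
  by apply/eqP; rewrite eq_le measure_ge0 andbT (le_trans le0)// e0 eL adde0.
- move=> x /= /not_implyP[]; rewrite in_itv/= => /andP[x0 xL] nP.
  have [->|x0'] := eqVneq x 0; first by left.
  have [->|xL'] := eqVneq x L; first by right.
  by exfalso; apply: nP; apply: H; rewrite in_itv/= !lt_neqAle x0 xL xL' eq_sym x0'.
Qed.

(** * Fixed points in the ball and roots of the scalar equation *)

Section fixed_point.
Context (a b c : R) (p : R -> R) (a0 : 0 < a) (b0 : 0 < b) (c0 : 0 < c).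
Context (intp : L1 L p) (p0 : {ae mu, forall x, x \in `[0, L] -> 0 <= p x}).
Context (p_small : normL1 L p < 2 * a ^+ 2 * constM L a c ^+ 2 / (b * L ^+ 2 * constN L a
  c)).

Let M := constM L a c.
Let N := constN L a c.

Let M1 : 1 <= M. Proof. exact: M_ge1. Qed.
Let M0 : 0 < M. Proof. exact: lt_le_trans M1. Qed.

Let integ_kh_ge0 k : 0 < k -> 0 <= integ L (kh k).
Proof. by move=> k0; apply: integ_ge0 => x; exact: kh_ge0. Qed.

Let MN : M <= N.
Proof.
rewrite /N constNE// lerDl mulr_ge0 ?integ_kh_ge0// mulr_ge0 ?ltW//.
by rewrite divr_gt0// exprn_gt0.
Qed.

Let N0 : 0 < N. Proof. exact: lt_le_trans MN. Qed.

Lemma normL1_nonneg : normL1 L p = integ L p.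
Proof.
apply: eq_ae_integ => //; first exact: L1_norm.
by apply: aeS p0 => x px xL; rewrite ger0_norm// px.
Qed.

Lemma p_smallM : b * L ^+ 2 * N * normL1 L p < 2 * a ^+ 2 * M ^+ 2.
Proof.
have D0 : 0 < b * L ^+ 2 * N by rewrite !mulr_gt0// exprn_gt0.
by rewrite mulrC -ltr_pdivlMr.
Qed.

Lemma beam_mean w w1 w2 w3 : 0 < a + b * integ L w ->
  beam w w1 w2 w3 (fun x => (a + b * integ L w) * w2 x + (p x - c * integ L w)) ->
  mean_equation a b c p (integ L w).
Proof.
set z := integ L w => k0 bw.
have intpz : L1 L (fun x => p x - c * z) by apply: L1B => //; exact: L1_cst.
have := beam_duality _ _ _ _ _ _ _ _ _ _ _ intpz (L1_cst 1) bw (kg_beam _ k0).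
rewrite (eq_integ _ w) => [|x _]; last exact: mulr1.
rewrite (eq_integ (fun x => kg (a + b * z) x * (p x - c * z)) (fun x => kg (a + b * z) x
  * p x - (c * z) * kg (a + b * z) x)) => [|x _]; last by ring.
have ig : L1 L (kg (a + b * z)) by exact/L1_within_continuous/kg_continuous.
rewrite integB; [|exact: L1_kgload|exact: L1Zl].
rewrite integZ// -/z /mean_equation /kgload => zE.
by rewrite mulrDr mulr1 {1}zE mulrA [z * c]mulrC subrK.
Qed.

(* If [z = integ L w] were negative, the load [p - c z], hence [- w''] and then [w],
   would be nonnegative. *)
Lemma beam_mean_ge0 w w1 w2 w3 : 0 < a + b * integ L w ->
  beam w w1 w2 w3 (fun x => (a + b * integ L w) * w2 x + (p x - c * integ L w)) ->
  0 <= integ L w.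
Proof.
set z := integ L w => k0 [pw pw1 pw2 pw3 [w0 wL w20 w2L]].
rewrite leNgt; apply/negP => z0.
have u0 := dirichlet_ge0 _ _ _ _ k0 (primitiveN _ _ pw2) (primitiveN _ _ pw3).
have {}u0 : forall x, 0 <= x <= L -> 0 <= - w2 x.
  apply: u0; rewrite ?w20 ?w2L ?oppr0//.
  apply: aeS p0 => x px xL; have cz : c * z <= 0 by rewrite mulr_ge0_le0 ?ltW.
  by have := px xL; rewrite mulrN; lra.
have w_ge0 : forall x, 0 <= x <= L -> 0 <= w x.
  apply: (concave_ge0 _ _ _ pw pw1); rewrite ?w0 ?wL//.
  by apply: aeW => x; rewrite in_itv/= -oppr_ge0 => /u0.
by have := integ_ge0 _ w_ge0; rewrite leNgt -/z z0.
Qed.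

(** Duality with [g_a] gives [z M = \int g_a psi], so [|z| M <= L^2 P / (4 a)] with [P] the norm of
    [p]. Since [M <= N], smallness gives [b L^2 P < 2 a^2 M], and in fact [b z > - a / 2]. *)
Lemma beam_mean_bound w w1 w2 w3 psi : L1 L psi -> normL1 L psi <= 2 * normL1 L p ->
  beam w w1 w2 w3 (fun x => a * w2 x + (psi x - c * integ L w)) ->
  0 < a + b * integ L w.
Proof.
set z := integ L w => intpsi psile bw.
have intpz : L1 L (fun x => psi x - c * z) by apply: L1B => //; exact: L1_cst.
have := beam_duality _ _ _ _ _ _ _ _ _ _ _ intpz (L1_cst 1) bw (kg_beam _ a0).
rewrite (eq_integ _ w) => [|x _]; last exact: mulr1.
rewrite (eq_integ (fun x => kg a x * (psi x - c * z)) (fun x => kg a x * psi x - (c * z)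
  * kg a x)) => [|x _]; last by ring.
have ig : L1 L (kg a) by exact/L1_within_continuous/kg_continuous.
have igpsi : L1 L (fun x => kg a x * psi x) by exact: L1_kgload.
rewrite integB//; last exact: L1Zl.
rewrite integZ// -/z => zE.
have zM : z * M = integ L (fun x => kg a x * psi x).
  by rewrite /M constME// mulrDr mulr1 {1}zE mulrA [z * c]mulrC subrK.
have low : - (L ^+ 2 / (8 * a) * normL1 L psi) <= z * M.
  rewrite zM /normL1 -integZ; last exact: L1_norm.
  rewrite -mulN1r -integZ; last exact/L1Zl/L1_norm.
  apply: integ_le => //; first exact/L1Zl/L1Zl/L1_norm.
  move=> x xL; rewrite mulN1r.
  have h1 := kg_le _ a0 _ xL; have h2 := kg_ge0 _ a0 _ xL.
  have h3 : kg a x * `|psi x| <= L ^+ 2 / (8 * a) * `|psi x| by rewrite ler_wpM2r.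
  have : - (kg a x * psi x) <= `|kg a x * psi x| by rewrite -normrN ler_norm.
  rewrite normrM (ger0_norm h2); lra.
have P0 : 0 <= normL1 L p by apply: integ_ge0.
have S := p_smallM; set P := normL1 L p in psile S P0 *.
have E : L ^+ 2 / (8 * a) * normL1 L psi <= L ^+ 2 * P / (4 * a).
  have -> : L ^+ 2 * P / (4 * a) = L ^+ 2 / (8 * a) * (2 * P) by field; rewrite gt_eqF.
  by rewrite ler_wpM2l// divr_ge0 ?sqr_ge0// mulr_ge0// ltW.
have zlow : - (L ^+ 2 * P) <= 4 * a * (z * M).
  have : - (L ^+ 2 * P / (4 * a)) <= z * M by lra.
  rewrite -mulNr ler_pdivrMr; last by rewrite mulr_gt0.
  by rewrite [_ * (4 * a)]mulrC.
have S' : b * L ^+ 2 * M * P < 2 * a ^+ 2 * M ^+ 2.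
  apply: le_lt_trans S; rewrite ler_wpM2r// ler_wpM2l//.
  by rewrite mulr_ge0 ?sqr_ge0// ltW.
have S2 : b * (L ^+ 2 * P) < 2 * a ^+ 2 * M.
  rewrite -(ltr_pM2r M0) (_ : b * (L ^+ 2 * P) * M = b * L ^+ 2 * M * P); last by ring.
  by rewrite (_ : 2 * a ^+ 2 * M * M = 2 * a ^+ 2 * M ^+ 2)//; ring.
have B : - (b * (L ^+ 2 * P)) <= b * (4 * a * (z * M)).
  by rewrite -mulrN ler_pM2l.
have F : 0 < (4 * a * M) * (a + b * z).
  have -> : (4 * a * M) * (a + b * z) = 4 * (a ^+ 2 * M) + b * (4 * a * (z * M)) by ring.
  have : 0 < a ^+ 2 * M by rewrite mulr_gt0 ?exprn_gt0.
  lra.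
by rewrite pmulr_rgt0 in F; last by rewrite !mulr_gt0.
Qed.

(** Here [- v''] is the Dirichlet response to [p], so by duality its integral is
    [\int h_k p <= P / a]. With [\int h_k <= \int h_a = I], the excess over [P] is at most
    [b z (P / a + c z I)], and it remains to bound this by [P]. *)
Lemma beam_load_norm z w2 v v1 v2 v3 : 0 <= z -> mean_equation a b c p z ->
  beam v v1 v2 v3 (fun x => (a + b * z) * v2 x + p x) ->
  (forall x, w2 x = v2 x + c * z * kh (a + b * z) x) ->
  normL1 L (fun x => p x + b * z * w2 x) <= 2 * normL1 L p.
Proof.
set k := a + b * z => z0 Ez bv w2E.
have ak : a <= k by rewrite lerDl mulr_ge0// ltW.
have k0 : 0 < k by exact: lt_le_trans ak.
have [pv pv1 pv2 pv3 [v0 vL v20 v2L]] := bv.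
have ih : L1 L (kh k) by exact/L1_within_continuous/kh_continuous.
have iv : L1 L v2 by exact/L1_within_continuous/(primitive_continuous _ _ pv2).
have cz0 : 0 <= c * z by rewrite mulr_ge0// ltW.
have bz0 : 0 <= b * z by rewrite mulr_ge0// ltW.
have pu1 : primitive (fun x => - v3 x) (fun x => k * - v2 x - p x).
  by apply: (primitive_ext _ _ _ _ (primitiveN _ _ pv3)) => x _ //; ring.
have u0 : forall x, 0 <= x <= L -> 0 <= - v2 x.
  apply: (dirichlet_ge0 _ _ _ _ k0 (primitiveN _ _ pv2) pu1); rewrite ?v20 ?v2L ?oppr0//.
  by apply: aeS p0 => x px xL; have := px xL; lra.
have uE : integ L (fun x => - v2 x) = integ L (fun x => kh k x * p x).
  rewrite -(dirichlet_duality k _ _ p _ _ (fun=> 1) intp (L1_cst 1) (primitiveN _ _ pv2)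
    pu1 _ _
    (primitive_kh _ k0) (primitive_kh1 _ k0) (kh0 _) (khL _)) ?v20 ?v2L ?oppr0//.
  by apply: eq_integ => x _; rewrite mulr1.
set P := normL1 L p; set I := integ L (kh a).
have P0 : 0 <= P by apply: integ_ge0.
have I0 : 0 <= I by exact: integ_kh_ge0.
have uP : integ L (fun x => - v2 x) <= P / a.
  rewrite uE /P normL1_nonneg mulrC -integZ//; apply: ae_integ_le; [|exact: L1Zl|].
    by apply: L1Ml => //; exact: kh_continuous.
  apply: aeS p0 => x px /[dup] xL; rewrite in_itv/= => xL'.
  rewrite ler_wpM2r ?px// (le_trans (kh_le _ k0 _ xL'))// lef_pV2// posrE//.
have hI : integ L (kh k) <= I.
  by apply: integ_le => // [|x xL]; [exact/L1_within_continuous/kh_continuous|exact: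
    kh_anti].
have zb := mean_equation_le _ _ _ _ a0 b0 c0 intp p0 _ z0 Ez.
rewrite -/M -normL1_nonneg -/P in zb.
have S := p_smallM; rewrite -/P in S.
have NE : N = M + c * (L ^+ 2 / 8) * I by rewrite /N constNE.
have step : normL1 L (fun x => p x + b * z * w2 x) <= P + b * z * (P / a + c * z * I).
  apply: (@le_trans _ _ (integ L (fun x => `|p x| + b * z * (- v2 x + c * z * kh k x)))).
    apply: integ_le.
    - apply/L1_norm/L1D/L1Zl => //.
      rewrite (_ : w2 = fun x => v2 x + c * z * kh k x); last exact/funext.
      exact/L1D/L1Zl.
    - by apply: L1D; [exact: L1_norm|exact/L1Zl/L1D/L1Zl/ih/L1N].
    - move=> x xL; rewrite (le_trans (ler_normD _ _))// lerD2l normrM (ger0_norm bz0).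
      rewrite ler_wpM2l// w2E (le_trans (ler_normD _ _))// -normrN ger0_norm ?u0// lerD2l.
      by rewrite ger0_norm// mulr_ge0// kh_ge0.
  rewrite integD; [|exact: L1_norm|exact/L1Zl/L1D/L1Zl/ih/L1N].
  rewrite -/(normL1 L p) -/P lerD2l integZ; last exact/L1D/L1Zl/ih/L1N.
  rewrite ler_wpM2l// integD; [|exact: L1N|exact: L1Zl].
  by rewrite lerD// integZ// ler_wpM2l.
apply: (le_trans step).
have aM0 : 0 < a * M by rewrite mulr_gt0.
(* From [z a M <= L^2 P / 8] and [N - M = c (L^2 / 8) I]; added to [P / a = P M / (a M)], this makes
   [N] appear. *)
have czI : c * z * I <= P * (N - M) / (a * M).
  rewrite ler_pdivlMr//.
  have -> : P * (N - M) = c * I * (L ^+ 2 / 8 * P) by rewrite NE; ring.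
  have -> : c * z * I * (a * M) = c * I * (z * (a * M)) by ring.
  by rewrite ler_wpM2l// mulr_ge0// ltW.
have sum : P / a + c * z * I <= P * N / (a * M).
  have -> : P * N / (a * M) = P / a + P * (N - M) / (a * M).
    by field; rewrite !gt_eqF.
  by rewrite lerD2l.
(* The bound on [z] gives [b z N a M <= b L^2 N P / 8], which smallness puts below [a^2 M^2 / 4]. *)
have bzN : b * z * N <= a * M.
  rewrite -(ler_pM2r aM0).
  have -> : b * z * N * (a * M) = b * N * (z * (a * M)) by ring.
  apply: (@le_trans _ _ (b * N * (L ^+ 2 / 8 * P))).
    by rewrite ler_pM2l// mulr_gt0.
  have -> : b * N * (L ^+ 2 / 8 * P) = (b * L ^+ 2 * N * P) / 8 by field.
  have -> : a * M * (a * M) = a ^+ 2 * M ^+ 2 by ring.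
  have : 0 < a ^+ 2 * M ^+ 2 by rewrite mulr_gt0 ?exprn_gt0.
  rewrite (_ : 2 * a ^+ 2 * M ^+ 2 = 2 * (a ^+ 2 * M ^+ 2)) in S; last by ring.
  lra.
suff : b * z * (P / a + c * z * I) <= P by lra.
apply: (@le_trans _ _ (b * z * (P * N / (a * M)))); first by rewrite ler_wpM2l.
have -> : b * z * (P * N / (a * M)) = P * (b * z * N / (a * M)) by ring.
by rewrite ler_piMr// ler_pdivrMr// mul1r.
Qed.

(** The ball bound is used while the equation still has coefficient [a] and load [psi]; this yields
    [a + b z > 0]. Only then is [psi] replaced, almost everywhere, by [p + b z w''], which moves
    [b z] into the coefficient and opens the way to the sign of [z] and the scalar equation. *)
Lemma fixed_point_beam psi : fixed_point_in_ball L a b c p psi ->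
  exists w w1 w2 w3,
  [/\ 0 <= integ L w, mean_equation a b c p (integ L w),
      beam w w1 w2 w3 (fun x => (a + b * integ L w) * w2 x + (p x - c * integ L w)),
      forall x, 0 <= x <= L -> opS L a c psi x = w x
    & aeEq L psi (fun x => p x + b * integ L w * w2 x)].
Proof.
move=> [[intpsi psile] fix_psi].
have [w [w1 [w2 [w3 bw]]]] := opS_beam a c a0 c0 _ intpsi.
have SE := beam_opS a c a0 c0 _ _ _ _ _ intpsi bw.
have [_ S2 _] := beam_derive1n _ _ _ _ _ _ bw SE.
have zE : integ L (opS L a c psi) = integ L w by exact: eq_integ.
have psiE : aeEq L psi (fun x => p x + b * integ L w * w2 x).
  have AE : {ae mu, forall x, x \in `[0, L] -> opA L a b c p psi x = p x + b * integ L w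
    * w2 x}.
    by apply: aeW_oo => x xL; rewrite /opA zE S2.
  by apply: aeS2 AE fix_psi => x AE fix_psi xL; rewrite -AE// fix_psi.
have k0 := beam_mean_bound _ _ _ _ _ intpsi psile bw.
have bw' : beam w w1 w2 w3 (fun x => (a + b * integ L w) * w2 x + (p x - c * integ L w)).
  have [pw pw1 pw2 pw3 BC] := bw; split => //.
  apply: (primitive_eq_ae _ _ _ pw3).
    have iw : L1 L w2 by exact/L1_within_continuous/(primitive_continuous _ _ pw2).
    apply: L1D; first exact: L1Zl.
    by apply: L1B => //; exact: L1_cst.
  by apply: aeS psiE => x psiE xL; rewrite psiE//; ring.
exists w, w1, w2, w3; split => //; [exact: beam_mean_ge0 bw'|exact: beam_mean bw'].
Qed.

(** Built backwards from a root [z]: if [v] is the response to [p] with coefficient [k = a + b z],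
    then [w = v - c z g_k] has integral [z] exactly by the scalar equation, and [phi = p + b z w'']
    is the load that [w] carries for coefficient [a]. *)
Lemma fixed_point_exists : exists phi, fixed_point_in_ball L a b c p phi.
Proof.
have [z z0 Ez] := mean_equation_exists _ _ _ _ a0 b0 c0 intp p0.
set k := a + b * z.
have k0 : 0 < k by rewrite ltr_pwDl// mulr_ge0// ltW.
have [v [v1 [v2 [v3 bv]]]] := beam_exists _ _ k0 intp.
have bg := kg_beam _ k0.
have B := beamB _ _ _ _ _ _ _ _ _ _ _ bv (beamZ _ (c * z) _ _ _ _ _ bg).
rewrite mulr1 in B.
set w := (fun x => v x - _) in B; set w2 := (fun x => v2 x - _) in B.
have [pv _ _ _ _] := bv.
have iv : L1 L v by exact/L1_within_continuous/(primitive_continuous _ _ pv).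
have ig : L1 L (kg k) by exact/L1_within_continuous/kg_continuous.
have zw : integ L w = z.
  rewrite integB//; last exact: L1Zl.
  rewrite integZ//.
  have := beam_duality _ _ _ _ _ _ _ _ _ _ _ intp (L1_cst 1) bv bg.
  rewrite (eq_integ _ v) => [->|x _]; last exact: mulr1.
  rewrite -/(kgload p k) -[kgload p k]Ez; ring.
pose phi x := p x + b * z * w2 x.
have [pw pw1 pw2 pw3 BC] := B.
have iw : L1 L w2 by exact/L1_within_continuous/(primitive_continuous _ _ pw2).
have intphi : L1 L phi by apply: L1D => //; exact: L1Zl.
have Ba : beam w (fun x => v1 x - c * z * kg1 k x) w2 (fun x => v3 x - c * z * - kh1 k x)
   (fun x => a * w2 x + (phi x - c * integ L w)).
  split => //; apply: (primitive_ext _ _ _ _ pw3) => x _ //.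
  by rewrite zw /phi /k /w2; ring.
have SE := beam_opS a c a0 c0 _ _ _ _ _ intphi Ba.
have [_ S2 _] := beam_derive1n _ _ _ _ _ _ Ba SE.
exists phi; split; last first.
  apply: aeW_oo => x xL; rewrite /opA S2//.
  by rewrite (_ : integ L _ = z)// -zw; exact: eq_integ.
split=> //; apply: (beam_load_norm _ _ _ _ _ _ z0 Ez bv) => x.
by rewrite /w2; ring.
Qed.

Lemma beam_mean_unique w w1 w2 w3 v v1 v2 v3 : 0 <= integ L w -> 0 <= integ L v ->
  mean_equation a b c p (integ L w) -> mean_equation a b c p (integ L v) ->
  beam w w1 w2 w3 (fun x => (a + b * integ L w) * w2 x + (p x - c * integ L w)) ->
  beam v v1 v2 v3 (fun x => (a + b * integ L v) * v2 x + (p x - c * integ L v)) ->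
  integ L w = integ L v /\ forall x, 0 <= x <= L -> w x = v x.
Proof.
move=> z0 z'0 Ez Ez' bw bv.
have zz := mean_equation_unique _ _ _ _ a0 b0 c0 intp p0 _ _ z0 z'0 Ez Ez'.
split=> //; rewrite -zz in bv.
apply: (beam_unique _ _ _ _ _ _ _ _ _ _ _ _ bw bv).
- by rewrite ltr_pwDl// mulr_ge0// ltW.
- by apply: L1B => //; exact: L1_cst.
Qed.

End fixed_point.

End primitives.

Theorem theorem3p3 (R : realType) (L a b c : R) (p : R -> R)
    (L_gt0 : 0 < L) (a_gt0 : 0 < a) (b_gt0 : 0 < b) (c_gt0 : 0 < c)
    (p_L1 : L1 L p)
    (p_ge0 : {ae @lebesgue_measure R, forall x, x \in `[0, L] -> 0 <= p x})
    (p_small : 2 * a ^+ 2 * constM L a c ^+ 2 / (b * L ^+ 2 * constN L a c)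
               > normL1 L p) :
  (exists phi : R -> R,
    [/\ fixed_point_in_ball L a b c p phi,
        forall psi : R -> R, fixed_point_in_ball L a b c p psi ->
          aeEq L psi phi,
        bvp_solution L a b c p (opS L a c phi)
      & 0 <= integ L (opS L a c phi)]) /\
  (exists w : R -> R,
    [/\ bvp_solution L a b c p w,
        0 <= integ L w
      & forall v : R -> R, bvp_solution L a b c p v -> 0 <= integ L v ->
          forall x, x \in `[0, L] -> v x = w x]).
Proof.
have mem_cc (x : R) : x \in `[0, L] -> 0 <= x <= L by rewrite in_itv.
have [phi fix_phi] := fixed_point_exists _ L_gt0 _ _ _ _ a_gt0 b_gt0 c_gt0 p_L1 p_ge0 p_small.
have fp := fixed_point_beam _ L_gt0 _ _ _ _ a_gt0 b_gt0 c_gt0 p_L1 p_ge0 p_small.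
have [w [w1 [w2 [w3 [z0 Ez bw SE phiE]]]]] := fp _ fix_phi.
have mu_beam := beam_mean_unique _ L_gt0 _ _ _ _ a_gt0 b_gt0 c_gt0 p_L1 p_ge0.
have zE : integ L (opS L a c phi) = integ L w by exact: eq_integ.
have solS := beam_bvp _ L_gt0 _ _ _ _ _ _ _ _ _ bw SE.
have zS : 0 <= integ L (opS L a c phi) by rewrite zE.
split; [exists phi; split; [exact: fix_phi| |exact: solS|exact: zS]
  |exists (opS L a c phi); split; [exact: solS|exact: zS|]].
- move=> psi /fp[v [v1 [v2 [v3 [z'0 Ez' bv _ psiE]]]]].
  have [zz wv] := mu_beam _ _ _ _ _ _ _ _ z0 z'0 Ez Ez' bw bv.
  (* The second derivatives are compared as derivatives of functions that agree on [[0, L]]; this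
     settles the open interval, hence almost every point. *)
  have [_ W2 _] := beam_derive1n _ L_gt0 _ _ _ _ _ _ bw (fun _ _ => erefl).
  have [_ V2 _] := beam_derive1n _ L_gt0 _ _ _ _ _ w bv wv.
  have vw2 : {ae @lebesgue_measure R, forall x, x \in `[0, L] -> v2 x = w2 x}.
    by apply: aeW_oo => // x xL; rewrite -V2// W2.
  have psiE' : aeEq L psi (fun x => p x + b * integ L w * w2 x).
    by apply: aeS2 psiE vw2 => x psiE vw2 xL; rewrite psiE// zz vw2.
  by apply: aeS2 psiE' phiE => x psiE' phiE xL; rewrite psiE'// phiE.
- move=> v bvpv v0 x /mem_cc xL.
  have [f [f1 [f2 [f3 [bf vf]]]]] := bvp_beam _ L_gt0 _ _ _ _ _ p_L1 bvpv.
  have zf : integ L v = integ L f by exact: eq_integ.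
  rewrite zf in v0.
  (* For an arbitrary solution it is the sign of its integral, not a norm bound, that makes the
     coefficient positive. *)
  have k0 : 0 < a + b * integ L f by rewrite ltr_pwDl// mulr_ge0// ltW.
  have Ef := beam_mean _ L_gt0 _ _ _ _ p_L1 _ _ _ _ k0 bf.
  have [_ wf] := mu_beam _ _ _ _ _ _ _ _ z0 v0 Ez Ef bw bf.
  by rewrite vf// SE// wf.
Qed.
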